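(* Let $1\le l\le m$, let $\mathcal T$ be an $m$-linear operator, let $\vec b=(b_1,\dots,b_l)\in \mathrm{BMO}(\mathbb R^n)^l$, and suppose that the iterated commutator $\mathcal T_{\vec b}$ satisfies the local sparse domination hypothesis (LSD) of the context. Then there are constants $\alpha_2,c_2>0$, independent of $w$, such that for every weight $w\in A_\infty^{\mathrm{weak}}$, every cube $Q\subset\mathbb R^n$, and all bounded compactly supported $f_1,\dots,f_m$ with $\operatorname{supp}f_s\subset Q$ for $1\le s\le m$, $$w\big(\{x\in Q:\ |\mathcal T_{\vec b}(\vec f)(x)|>t\,\mathcal M_{L(\log L)}(\vec f)(x)\}\big)\le c_2\exp\Big(-\frac{\alpha_2}{[w]_{A_\infty}^{\mathrm{weak}}+1}\Big(\frac{t}{\prod_{s=1}^l\|b_s\|_{\mathrm{BMO}}}\Big)^{\frac1{l+1}}\Big)w(2Q),\qquad t>0.$$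
   Context: Cubes have sides parallel to the axes; $rQ$ is the cube with the same center as $Q$ and side length $r$ times that of $Q$. $\langle g\rangle_Q=\frac1{|Q|}\int_Q g$. $\|b\|_{\mathrm{BMO}}=\sup_Q\langle|b-\langle b\rangle_Q|\rangle_Q$. A weight is a nonnegative locally integrable function; $w(E)=\int_Ew$. Weak $A_\infty$. $w\in A_\infty^{\mathrm{weak}}$ if there are $0<c,\delta<\infty$ with $w(E)\le c(|E|/|Q|)^\delta w(2Q)$ for all cubes $Q$ and measurable $E\subset Q$; $[w]_{A_\infty}^{\mathrm{weak}}=\sup_Q\frac1{w(2Q)}\int_QM(w\chi_Q)$, with $M$ the Hardy–Littlewood maximal operator over cubes. Iterated commutator. For an $m$-linear operator $\mathcal T$ acting on (suitable) functions on $\mathbb R^n$, and $\vec b=(b_1,\dots,b_l)$, set $[\mathcal T,\vec b]_{e_i}(\vec f)(x)=b_i(x)\mathcal T(f_1,\dots,f_m)(x)-\mathcal T(f_1,\dots,b_if_i,\dots,f_m)(x)$ and $\mathcal T_{\vec b}=[\cdots[[\mathcal T,\vec b]_{e_1},\vec b]_{e_2}\cdots,\vec b]_{e_l}$. Sparse families. $\mathcal D(Q_0)$ is the set of dyadic cubes obtained by repeatedly subdividing $Q_0$ and its descendants into $2^n$ cubes of equal side length. A family $\mathcal S\subset\mathcal D(Q_0)$ is $\eta$-sparse, $\eta\in(0,1)$, if $|\bigcup_{P\in\mathcal S,P\subsetneq Q}P|\le(1-\eta)|Q|$ for all $Q\in\mathcal S$. Hypothesis (LSD). There are constants $C>0$,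 $\eta\in(0,1)$ such that for every cube $Q_0$ and all bounded compactly supported $f_1,\dots,f_m$ there is an $\eta$-sparse family $\mathcal F\subset\mathcal D(Q_0)$ with, for a.e. $x\in Q_0$, $$|\mathcal T_{\vec b}(f_1\chi_{3Q_0},\dots,f_m\chi_{3Q_0})(x)|\le C\sum_{Q\in\mathcal F}\Big(\sum_{\vec\gamma\in\{1,2\}^l}\prod_{s=1}^l\mathcal R(b_s,f_s,Q,\gamma_s)(x)\Big)\prod_{s=l+1}^m\langle|f_s|\rangle_{3Q}\,\chi_Q(x),$$ where $\mathcal R(b,f,Q,1)(x)=|b(x)-\langle b\rangle_{3Q}|\langle|f|\rangle_{3Q}$ and $\mathcal R(b,f,Q,2)(x)=\langle|(b-\langle b\rangle_{3Q})f|\rangle_{3Q}$. Maximal function. $\|f\|_{L(\log L),Q}=\inf\{\lambda>0:\frac1{|Q|}\int_Q\phi(|f|/\lambda)\le1\}$ with $\phi(t)=t\log(e+t)$; $\mathcal M_{L(\log L)}(\vec f)(x)=\sup_{R\ni x}\prod_{i=1}^m\|f_i\|_{L(\log L),R}$ over cubes $R\ni x$. *)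

(* Defs.v *)
From HB Require Import structures.
From mathcomp Require Import all_boot all_order all_algebra.
From mathcomp Require Import all_classical all_reals all_analysis.

Set Implicit Arguments.
Unset Strict Implicit.
Unset Printing Implicit Defensive.
Import Order.TTheory GRing.Theory Num.Theory.
Import numFieldNormedType.Exports.

Local Open Scope classical_set_scope.
Local Open Scope ring_scope.

(* R^d, d >= 1, is 'rV[R]_d with d = n.+1. *)

Section lebesgue.
Context {R : realType} {n : nat}.
Local Notation E := 'rV[R]_n.+1.

Definition box (B : E * E) : set E :=
  [set x | forall i, B.1 0 i <= x 0 i < B.2 0 i].

Definition box_vol (B : E * E) : R :=
  \prod_(i < n.+1) Num.max 0 (B.2 0 i - B.1 0 i).

Local Open Scope ereal_scope.

Definition box_cover (A : set E) : set (nat -> E * E) :=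
  [set B | A `<=` \bigcup_k box (B k)].

(* Lebesgue outer measure; its Caratheodory sets are the Lebesgue sets. *)
Definition leb_outer (A : set E) : \bar R :=
  ereal_inf [set \sum_(k <oo) (box_vol (B k))%:E | B in box_cover A].

Lemma box_vol_ge0 B : 0 <= (box_vol B)%:E.
Proof. by rewrite lee_fin prodr_ge0// => i _; rewrite le_max lexx. Qed.

Lemma leb_outer_ge0 A : 0 <= leb_outer A.
Proof.
apply: le_ereal_inf_tmp => x [B _ <-{x}].
by apply: nneseries_ge0 => k _ _; exact: box_vol_ge0.
Qed.

Lemma leb_outer0 : leb_outer set0 = 0.
Proof.
apply/eqP; rewrite eq_le leb_outer_ge0 andbT.
apply: ereal_inf_lbound; exists (fun=> (0%R, 0%R)) => //.
rewrite eseries0// => k _ _; rewrite /box_vol/= big_ord_recl !mxE subrr.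
by rewrite maxxx mul0r.
Qed.

Lemma le_leb_outer : {homo leb_outer : A B / A `<=` B >-> A <= B}.
Proof.
move=> A B AB; apply/ereal_inf_le_tmp => x [C BC <-{x}].
by exists C => //; exact: subset_trans AB BC.
Qed.

Lemma leb_outer_sigma_subadditive : sigma_subadditive leb_outer.
Proof.
move=> A; have [[i ioo]|] := pselect (exists i, leb_outer (A i) = +oo).
  rewrite (eseries_pinfty _ _ ioo) ?leey// => k _.
  by rewrite -ltNye (lt_le_trans _ (leb_outer_ge0 _)).
rewrite -forallNE => Aoo.
suff add2e (e : {posnum R}) :
    leb_outer (\bigcup_k A k) <= \sum_(i <oo) leb_outer (A i) + e%:num%:E.
  by apply/lee_addgt0Pr => _/posnumP[].
rewrite (le_trans _ (epsilon_trick _ _ _))//; last first.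
  by move=> k; exact: leb_outer_ge0.
pose P k (B : nat -> E * E) := box_cover (A k) B /\
  \sum_(j <oo) (box_vol (B j))%:E <=
    leb_outer (A k) + (e%:num / (2 ^ k.+1)%:R)%:E.
have [G PG] : {G : nat -> nat -> E * E & forall k, P k (G k)}.
  apply: (@choice _ _ P) => k; rewrite /P /leb_outer.
  set S := (X in ereal_inf X); move infS : (ereal_inf S) => iS.
  case: iS infS => [r Sr|Soo|Soo].
  - have en1 : (0 < e%:num / (2 ^ k.+1)%:R)%R by [].
    have /(lb_ereal_inf_adherent en1) : ereal_inf S \is a fin_num by rewrite Sr.
    move=> [x [B AnB muBx] xS].
    by exists B; split => //; rewrite muBx -Sr; exact/ltW.
  - by have := Aoo k; rewrite /leb_outer Soo.
  - suff : lbound S 0 by move/le_ereal_inf_tmp; rewrite Soo.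
    move=> /= _ [B AnB <-]; apply: nneseries_ge0 => ? _ _.
    exact: box_vol_ge0.
pose mu B := (box_vol B)%:E.
have muG_ge0 x : 0 <= (mu \o uncurry G) x by exact: box_vol_ge0.
apply: (@le_trans _ _ (\esum_(i in setT) (mu \o uncurry G) i)).
  apply: ereal_inf_lbound => /=.
  have /card_esym/ppcard_eqP[f] := card_nat2.
  exists (uncurry G \o f).
    move=> t [i _]; move: (PG i) => [+ _] => /[apply] -[j _ Bijt].
    exists (f^-1%FUN (i, j)) => //=.
    by rewrite invK ?inE.
  rewrite -(esum_pred_image (mu \o uncurry G) _ xpredT) ?[fun=> _]set_true//.
  by rewrite image_eq.
rewrite (_ : esum _ _ = \sum_(i <oo) \sum_(j <oo ) mu (G i j)); last first.
  pose J : nat -> set (nat * nat) := fun i => [set (i, j) | j in setT].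
  rewrite (_ : setT = \bigcup_k J k); last first.
    by rewrite predeqE => -[a b]; split => // _; exists a => //; exists b.
  rewrite esum_bigcupT /=; last 2 first.
    - apply/trivIsetP => i j _ _ ij.
      rewrite predeqE => -[p m] /=; split => //= -[] [_] _ [<-{p} _].
      by move=> [m' _] [] /esym/eqP; rewrite (negbTE ij).
    - by move=> /= [p m]; exact: box_vol_ge0.
  rewrite -(image_id [set: nat]) -fun_true esum_pred_image//; last first.
    by move=> k _; apply: esum_ge0 => ? _; exact: box_vol_ge0.
  apply: eq_eseriesr => /= j _.
  rewrite -(esum_pred_image (mu \o uncurry G) (pair j) predT)//=; last first.
    by move=> ? ? _ _; exact: (@can_inj _ _ _ snd).
    by move=> ? _; exact: box_vol_ge0.
  by congr esum; rewrite predeqE => -[a b]; split; move=> [i _ <-]; exists i.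
apply: lee_lim.
- apply: is_cvg_nneseries => k *.
  by apply: nneseries_ge0 => j *; exact: (muG_ge0 (k, j)).
- by apply: is_cvg_nneseries => k *; apply: adde_ge0 => //; exact: leb_outer_ge0.
- by near=> k; apply: lee_sum => i _; exact: (PG i).2.
Unshelve. all: by end_near. Qed.

HB.instance Definition _ := isOuterMeasure.Build R E leb_outer
  leb_outer0 leb_outer_ge0 le_leb_outer leb_outer_sigma_subadditive.

Definition leb_outer_measure : {outer_measure set E -> \bar R} := leb_outer.

End lebesgue.

Arguments leb_outer_measure : clear implicits.

Notation lebT R n := (caratheodory_type (leb_outer_measure R n)).

Definition leb (R : realType) (n : nat) : {measure set (lebT R n) -> \bar R} :=
  leb_outer_measure R n.

(* Axis-parallel cubes, encoded by center and side length *)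
Definition cube (R : realType) (n : nat) : choiceType :=
  ('rV[R]_n.+1 * {posnum R})%type.

Section cubes.
Context {R : realType} {n : nat}.
Local Notation E := 'rV[R]_n.+1.
Local Notation cube := (cube R n).
Local Notation mu := (leb R n).
Implicit Types (Q P : cube) (S : set cube).

Definition center Q : E := Q.1.

Definition side Q : R := Q.2%:num.

(* Half-open, so that the 2^d children of a cube partition it *)
Definition cube_set Q : set E :=
  [set x | forall i, center Q 0 i - side Q / 2 <= x 0 i
                     < center Q 0 i + side Q / 2].

Definition dilate (r : {posnum R}) Q : cube :=
  (center Q, (r%:num * Q.2%:num)%:pos).

Definition child Q (e : {ffun 'I_n.+1 -> bool}) : cube :=
  (center Q + \row_i ((-1) ^+ e i * (side Q / 4)), (Q.2%:num / 2)%:pos).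

Inductive dyadic (Q0 : cube) : cube -> Prop :=
| dyadic_refl : dyadic Q0 Q0
| dyadic_child Q e : dyadic Q0 Q -> dyadic Q0 (child Q e).

Definition sparse (eta : R) S := forall Q, S Q ->
  (mu (\bigcup_(P in [set P | S P /\ cube_set P `<` cube_set Q]) cube_set P)
    <= (1 - eta)%:E * mu (cube_set Q))%E.

End cubes.

Section function_spaces.
Context {R : realType} {n : nat}.
Local Notation E := 'rV[R]_n.+1.
Local Notation cube := (cube R n).
Local Notation mu := (leb R n).
Implicit Types (f b w : E -> R) (Q : cube).

Definition leb_measurable f := measurable_fun [set: lebT R n] (f : lebT R n -> R).

Local Open Scope ereal_scope.

Definition loc_integrable f := leb_measurable f /\
  forall K : set E, compact K -> \int[mu]_(x in K) `|f x|%:E < +oo.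

Definition bounded_compact_support f := [/\ leb_measurable f,
  (exists M : R, forall x, (`|f x| <= M)%R) &
  compact (closure [set x : E | f x != 0%R])].

Definition avg (g : E -> \bar R) Q : \bar R :=
  (\int[mu]_(x in cube_set Q) g x) / mu (cube_set Q).

Definition mean b Q : R := fine (avg (fun x => (b x)%:E) Q).

Definition bmo_norm b : \bar R :=
  ereal_sup [set avg (fun x => `|b x - mean b Q|%:E) Q | Q in [set: cube]].

Definition bmo b := loc_integrable b /\ bmo_norm b < +oo.

Definition maximal f (x : E) : \bar R :=
  ereal_sup [set avg (fun y => `|f y|%:E) Q | Q in [set Q | cube_set Q x]].

Definition weight w := (forall x, (0 <= w x)%R) /\ loc_integrable w.

Definition wmass w (A : set E) : \bar R := \int[mu]_(x in A) (w x)%:E.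

Definition weak_Ainfty w := exists c delta : R, [/\ (0 < c)%R, (0 < delta)%R &
  forall Q (A : set (lebT R n)), measurable A -> A `<=` cube_set Q ->
    wmass w A <=
      c%:E * (mu A / mu (cube_set Q)) `^ delta * wmass w (cube_set (dilate (2%:pos)%R Q))].

(* Here 0 / 0 = 0: if w vanishes a.e. on 2Q, the cube Q contributes 0. *)
Definition weak_Ainfty_const w : \bar R :=
  ereal_sup [set (\int[mu]_(x in cube_set Q) maximal (fun y => w y * \1_(cube_set Q) y)%R x)
                   / wmass w (cube_set (dilate (2%:pos)%R Q)) | Q in [set: cube]].

Definition phi (t : R) : R := (t * ln (expR 1 + t))%R.

Definition LlogL_norm f Q : \bar R :=
  ereal_inf [set lam%:E | lam in
    [set lam : R | (0 < lam)%R /\ avg (fun x => (phi (`|f x| / lam))%:E) Q <= 1]].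

Definition LlogL_maximal m (f : 'I_m -> E -> R) (x : E) : \bar R :=
  ereal_sup [set \prod_(i < m) LlogL_norm (f i) Q | Q in [set Q | cube_set Q x]].

End function_spaces.

Section operators.
Context {R : realType} {n l m : nat}.
Local Notation E := 'rV[R]_n.+1.
Local Notation cube := (cube R n).
Local Notation mu := (leb R n).
Implicit Types (T : ('I_m -> E -> R) -> E -> R) (D : set (E -> R)).
Implicit Types (f : 'I_m -> E -> R) (b : 'I_l -> E -> R) (Q : cube).

Definition update f (i : 'I_m) (u : E -> R) : 'I_m -> E -> R :=
  fun j => if j == i then u else f j.

(* T is an m-linear operator on D, the linear space of functions "suitable"
   for T; its values are functions defined up to null sets. *)
Definition multilinear_operator D T := [/\
  (forall (a : R) u v, D u -> D v -> D (fun x => a * u x + v x)),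
  (forall u, bounded_compact_support u -> D u),
  (forall f, (forall j, D (f j)) -> leb_measurable (T f)) &
  forall f i (a : R) u v, (forall j, D (f j)) -> D u -> D v ->
    {ae mu, forall x, T (update f i (fun y => a * u y + v y)) x =
                      a * T (update f i u) x + T (update f i v) x}].

Definition commutator T (i : 'I_m) (b : E -> R) : ('I_m -> E -> R) -> E -> R :=
  fun f x => b x * T f x - T (update f i (fun y => b y * f i y)) x.

Definition iter_commutator (lm : (l <= m)%N) T b :
    ('I_m -> E -> R) -> E -> R :=
  foldl (fun S i => commutator S (widen_ord lm i) (b i)) T (enum 'I_l).

Local Open Scope ereal_scope.

(* gamma = false, true encode the values 1, 2 of the third index. *)
Definition Rterm (b f : E -> R) Q (gamma : bool) (x : E) : \bar R :=
  let Q3 := dilate (3%:pos)%R Q in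
  if gamma then avg (fun y => `|(b y - mean b Q3) * f y|%:E) Q3
  else `|b x - mean b Q3|%:E * avg (fun y => `|f y|%:E) Q3.

Definition local_sparse_domination (lm : (l <= m)%N) T b :=
  exists C eta : R, [/\ (0 < C)%R, (0 < eta < 1)%R &
  forall (Q0 : cube) f, (forall s, bounded_compact_support (f s)) ->
  exists F : set cube, [/\ F `<=` dyadic Q0, sparse eta F &
  {ae mu, forall x, cube_set Q0 x ->
    `|iter_commutator lm T b
      (fun s y => f s y * \1_(cube_set (dilate 3%:pos Q0)) y)%R x|%:E
    <= C%:E * \esum_(Q in F)
      ((\sum_(gamma : {ffun 'I_l -> bool})
          \prod_(s < l) Rterm (b s) (f (widen_ord lm s)) Q (gamma s) x)
       * (\prod_(s < m | (l <= s)%N)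
            avg (fun y => `|f s y|%:E) (dilate (3%:pos)%R Q))
       * (\1_(cube_set Q) x)%:E)}]].

End operators.

(* Main.v *)
(* Fix a level [k]. By sparseness and the John-Nirenberg inequality, outside an
   exceptional set of measure O(r^k)|Q|, r < 1, a point x of Q lies in at most
   [k] cubes P of the sparse family, and |b_s(x) - <b_s>_{3P}| is at most a
   multiple of k ||b_s|| for each of them. At such a point the Hoelder inequality
   between exp L and L log L bounds every summand of the sparse domination by
   k^l prod ||b_s|| M_{L(log L)}(f)(x), hence the whole sum by k^{l+1} times the
   same quantity. So the level set of height t is contained in the exceptional
   set when t is a large multiple of k^{l+1} prod ||b_s||.

   Lebesgue measure is converted to w-mass by the implication
   |E| <= 2^{-Lk}|Q| ==> w(E) <= 2^{-k} w(2Q), with L = O([w] + 1). For a single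
   fixed factor it follows from the definition of [w], by averaging over N levels
   of the dyadic maximal function of w, with N of order [w]. Two such estimates
   compose: E is surrounded by a neighbourhood of the dyadic cubes in which it is
   dense, and inside a Whitney cube of this neighbourhood E is sparse.

   If prod ||b_s|| = 0, the ||b_s|| are replaced by positive upper bounds with
   arbitrarily small product, and k tends to infinity. *)
Require Import Defs.
From HB Require Import structures.
From mathcomp Require Import all_boot all_order all_algebra.
From mathcomp Require Import all_classical all_reals all_analysis.
From mathcomp Require Import measurable_realfun.
From mathcomp Require Import ring lra zify.

Set Implicit Arguments.
Unset Strict Implicit.
Import Order.TTheory GRing.Theory Num.Theory.
Import numFieldNormedType.Exports.
Local Open Scope classical_set_scope.
Local Open Scope ring_scope.
Local Open Scope ereal_scope.

(** * Countable sums and integrals *)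

(** The weight need not be doubling, and every estimate loses from Q to 2Q, so a naive iteration
    over nested cubes would run off to larger and larger cubes. This shapes the composition of two
    decay estimates. The doubles of the Whitney cubes overlap boundedly and stay inside the
    neighbourhood. The neighbourhood, which sticks out of Q, keeps a fixed distance from the
    boundary of 2Q and is cut into cubes so small that their doubles still lie in 2Q. Each
    composition costs a dimensional factor; it is paid in advance by making the factor of a single
    step smaller than its inverse, at the price of a dimensional multiple of [w] in N. The maximal
    function is a supremum over uncountably many cubes, so the level set is handled only through its
    inclusion in a measurable exceptional set. The level k is an integer, and all losses from
    rounding end up in the constant in front of the exponential. *)

Lemma esum_pickle (R : realType) (I : countType) (S : set I) (a : I -> \bar R) :
  (forall i, 0 <= a i) ->
  \esum_(i in S) a i =
  \sum_(k <oo) (if pickle_inv k is Some i then if i \in S then a i else 0 else 0).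
Proof.
move=> a0; rewrite nneseries_esumT; last first.
  by move=> k; case: (@pickle_inv I k) => // i; case: ifP.
set g := (fun k : nat => _).
have gi i : g (pickle i) = if i \in S then a i else 0 by rewrite /g pickleK_inv.
rewrite esum_mkcond (eq_esum (b := fun i => g (pickle i))) => [|i _]; last by rewrite gi.
rewrite -(@esum_image R _ _ setT (@pickle I) g); last first.
  by move=> x y _ _; exact: (pcan_inj pickleK).
rewrite esum_mkcond; apply: eq_esum => k _; case: ifPn => //.
rewrite notin_setE/= => kI; rewrite /g.
case E: pickle_inv (@pickle_invK I k) => [i|]//= ki.
by exfalso; apply: kI; exists i.
Qed.

Section esum_integral.
Context d (T : measurableType d) (R : realType) (mu : {measure set T -> \bar R}).
Implicit Types (I : countType).

Lemma measurable_esum I (S : set I) (f : I -> T -> \bar R) (D : set T) :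
  measurable D ->
  (forall i x, 0 <= f i x) -> (forall i, measurable_fun D (f i)) ->
  measurable_fun D (fun x => \esum_(i in S) f i x).
Proof.
move=> mD f0 mf.
under eq_fun do rewrite esum_pickle//.
apply: ge0_emeasurable_sum => //.
  by move=> k x Dx _; case: (@pickle_inv I k) => // i; case: ifP.
move=> k _; case: (@pickle_inv I k) => [i|]; last exact: measurable_cst.
by case: (i \in S).

Qed.

Lemma integral_esum I (S : set I) (f : I -> T -> \bar R) (D : set T) :
  measurable D ->
  (forall i x, 0 <= f i x) -> (forall i, measurable_fun D (f i)) ->
  \int[mu]_(x in D) (\esum_(i in S) f i x) =
  \esum_(i in S) \int[mu]_(x in D) f i x.
Proof.
move=> mD f0 mf; rewrite [RHS](@esum_pickle R I S (fun i => \int[mu]_(x in D) f i x)); last first.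
  by move=> i; exact: integral_ge0.
rewrite (eq_integral _ _ (fun x _ => esum_pickle S (f0^~ x))).
rewrite integral_nneseries//.
- apply: eq_eseriesr => k _; case: (@pickle_inv I k) => [i|]; last exact: integral0.
  by case: ifP => // _; exact: integral0.
- move=> k; case: (@pickle_inv I k) => [i|]; last exact: measurable_cst.
  by case: (i \in S).
- by move=> k x _; case: (@pickle_inv I k) => // i; case: ifP.
Qed.

(* On nonmeasurable data the integral of a nonnegative function is a lower
   integral, so that monotonicity needs no measurability. *)
Lemma le_integral_lower (A B : set T) (f g : T -> \bar R) :
  (forall x, A x -> 0 <= f x) -> (forall x, B x -> 0 <= g x) ->
  (forall x, A x -> f x != 0 -> B x /\ f x <= g x) ->
  \int[mu]_(x in A) f x <= \int[mu]_(x in B) g x.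
Proof.
move=> f0 g0 fg; rewrite !ge0_integralE//.
apply: ge_ereal_sup => _ [h hf <-]; apply: ereal_sup_ubound; exists h => // x.
apply: (le_trans (hf x)); rewrite !patchE.
case: ifPn => [|_]; last by case: ifPn => //; rewrite inE => /g0.
rewrite inE => Ax; have [->|fx0] := eqVneq (f x) 0.
  by case: ifPn => //; rewrite inE => /g0.
by have [Bx fgx] := fg _ Ax fx0; rewrite mem_set.
Qed.

End esum_integral.

(** * Lebesgue measure of cubes *)

Section lebesgue_measure_rV.
Context {R : realType}.

Lemma lebesgue_measure_itvco (a b : R) :
  lebesgue_measure `[a, b[ = (Num.max 0 (b - a))%:E :> \bar R.
Proof.
rewrite lebesgue_measure_itv/= lte_fin; case: ltP => ab.
  by rewrite -EFinD max_r// subr_ge0 ltW.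
by rewrite max_l// subr_le0.
Qed.

(** Induction on the dimension: integrating the pointwise inequality in the last coordinate, with
    the others fixed, turns the last indicator into an interval length. The weights [c] and [C]
    collect the lengths already produced. *)
Lemma box_covering_volume (d : nat) (c : R) (a b : nat -> R) (C : nat -> R)
    (A B : nat -> nat -> R) :
  (0 <= c)%R -> (forall k, (0 <= C k)%R) ->
  (forall x : nat -> R,
    (c * \prod_(i < d) \1_(`[a i, b i[) (x i))%:E <=
    \sum_(k <oo) (C k * \prod_(i < d) \1_(`[A k i, B k i[) (x i))%:E) ->
  (c * \prod_(i < d) Num.max 0 (b i - a i))%:E <=
    \sum_(k <oo) (C k * \prod_(i < d) Num.max 0 (B k i - A k i))%:E.
Proof.
elim: d c C => [|d IH] c C c0 C0 h.
  by have := h (fun=> 0%R); under eq_eseriesr do rewrite !big_ord0; under [X in _ -> _ <= X]eq_eseriesr do rewrite !big_ord0; rewrite !big_ord0.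
have max0 (u : R) : (0 <= Num.max 0 u)%R by rewrite le_max lexx.
have P0 (u v x : nat -> R) : (0 <= \prod_(i < d) \1_(`[u i, v i[) (x i) :> R)%R.
  by apply: prodr_ge0 => i _; rewrite indicE ler0n.
have IH' := IH (c * Num.max 0 (b d - a d))%R
  (fun k => C k * Num.max 0 (B k d - A k d))%R.
have -> : (c * \prod_(i < d.+1) Num.max 0 (b i - a i) =
  c * Num.max 0 (b d - a d) * \prod_(i < d) Num.max 0 (b i - a i))%R.
  by rewrite big_ord_recr/=; ring.
apply: le_trans (IH' _ _ _) _.
- by rewrite mulr_ge0.
- by move=> k; rewrite mulr_ge0.
- move=> x.
  have intE (e u v : R) : (0 <= e)%R ->
      \int[lebesgue_measure]_s (e * \1_(`[u, v[) s)%:E = (e * Num.max 0 (v - u))%:E.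
    move=> e0; under eq_integral do rewrite EFinM.
    rewrite ge0_integralZl//; last exact/measurable_EFinP.
    by rewrite integral_indic// setIT EFinM -lebesgue_measure_itvco.
  pose upd s := fun i => if i == d then s else x i.
  have updd s : upd s d = s by rewrite /upd eqxx.
  have updE s (u v : nat -> R) : (\prod_(i < d) \1_(`[u i, v i[) (upd s i) =
      \prod_(i < d) \1_(`[u i, v i[) (x i) :> R)%R.
    by apply: eq_bigr => i _; rewrite /upd ltn_eqF.
  have -> : (c * Num.max 0 (b d - a d) * \prod_(i < d) \1_(`[a i, b i[) (x i))%:E =
     \int[lebesgue_measure]_s (c * \prod_(i < d) \1_(`[a i, b i[) (x i) * \1_(`[a d, b d[) s)%:E.
    by rewrite intE ?mulr_ge0//; congr EFin; ring.
  have -> : \sum_(k <oo) (C k * Num.max 0 (B k d - A k d) *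
        \prod_(i < d) \1_(`[A k i, B k i[) (x i))%:E =
      \int[lebesgue_measure]_s \sum_(k <oo) (C k * \prod_(i < d) \1_(`[A k i, B k i[) (x i) *
         \1_(`[A k d, B k d[) s)%:E.
    rewrite integral_nneseries//.
    - by apply: eq_eseriesr => k _; rewrite intE ?mulr_ge0//; congr EFin; ring.
    - move=> k; apply/measurable_EFinP; apply: measurable_funM => //.
    - by move=> k s _; rewrite lee_fin !mulr_ge0// indicE ler0n.
  apply: le_integral_lower => [s _|s _|s _ _].
  + by rewrite lee_fin !mulr_ge0// indicE ler0n.
  + by apply: nneseries_ge0 => k _ _; rewrite lee_fin !mulr_ge0// indicE ler0n.
  + split => //; have := h (upd s).
    rewrite big_ord_recr/= updd updE mulrA => /le_trans; apply.
    apply: lee_nneseries => k _; first by rewrite lee_fin mulr_ge0// prodr_ge0// => i _; rewrite indicE ler0n.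
    by rewrite big_ord_recr/= updd updE mulrA.
- by apply: lee_nneseries => k _; [by rewrite lee_fin !mulr_ge0// prodr_ge0|
    by rewrite lee_fin big_ord_recr/= -!mulrA (mulrC (Num.max _ _))].
Qed.

End lebesgue_measure_rV.

Section lebesgue_cubes.
Context {R : realType} {n : nat}.
Local Notation E := 'rV[R]_n.+1.
Local Notation mu := (leb R n).
Local Notation center := Defs.center.
Implicit Types (Q P : cube R n) (A : set E).

Lemma le_leb_cover (A : set E) (B : nat -> E * E) : box_cover A B ->
  leb_outer A <= \sum_(k <oo) (box_vol (B k))%:E.
Proof. by move=> AB; apply: ereal_inf_lbound; exists B. Qed.

(** Caratheodory's criterion: the hyperplane cuts each box of a cover of [X] into two boxes, [lo]
    and [up], whose volumes add up, and these cover the two parts of [X]. *)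
Lemma measurable_halfspace (i : 'I_n.+1) (a : R) :
  measurable ([set x | x 0 i < a]%R : set (lebT R n)).
Proof.
apply: le_caratheodory_measurable => X.
apply: le_ereal_inf_tmp => _ [B XB <-].
pose lo k : E * E := ((B k).1,
  (\row_j (if j == i then Num.min ((B k).2 0 j) a else (B k).2 0 j))%R).
pose up k : E * E := ((\row_j (if j == i then Num.max ((B k).1 0 j) a else (B k).1 0 j))%R,
  (B k).2).
have -> : \sum_(k <oo) (box_vol (B k))%:E =
   \sum_(k <oo) (box_vol (lo k))%:E + \sum_(k <oo) (box_vol (up k))%:E.
  rewrite -nneseriesD//; try by move=> k _ _; exact: box_vol_ge0.
  apply: eq_eseriesr => k _; rewrite -EFinD; congr EFin.
  rewrite /box_vol (bigD1 i)//= [in RHS](bigD1 i)//= [X in _ = (_ + X)%R](bigD1 i)//=.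
  rewrite !mxE eqxx.
  under [X in _ = (_ * X + _)%R]eq_bigr => j ji do rewrite mxE (negbTE ji).
  under [X in _ = (_ + _ * X)%R]eq_bigr => j ji do rewrite mxE (negbTE ji).
  rewrite -mulrDl; congr (_ * _)%R.
  rewrite /Num.max /Num.min; repeat case: ifPn; rewrite -?leNgt; lra.
apply: leeD; apply: le_leb_cover => x.
- move=> [Xx/= xa]; have [k _ Bk] := XB _ Xx; exists k => // j.
  have /andP[B1 B2] := Bk j; rewrite B1/= mxE; case: eqP => // ->.
  by rewrite lt_min xa andbT; have /andP[] := Bk i.
- move=> [Xx/= xa]; have [k _ Bk] := XB _ Xx; exists k => // j.
  have /andP[B1 B2] := Bk j; rewrite B2/= andbT mxE; case: eqP => // ->.
  rewrite ge_max; have /andP[-> _] := Bk i.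
  by move/negP : xa; rewrite -leNgt.
Qed.

Lemma measurable_box (B : E * E) : measurable (box B : set (lebT R n)).
Proof.
have -> : box B = \bigcap_(i in [set: 'I_n.+1])
    ([set x : E | x 0 i < B.2 0 i]%R `\` [set x | x 0 i < B.1 0 i]%R).
  rewrite predeqE => x; split.
    move=> Bx i _; have := Bx i; move=> /andP[B1 B2]; split => //=.
    by apply/negP; rewrite -leNgt.
  by move=> h i; have [/= -> /negP] := h i I; rewrite -leNgt andbT.
apply: fin_bigcap_measurable => // i _.
apply: measurableD; exact: measurable_halfspace.
Qed.

Definition cube_box Q : E * E :=
  (\row_i (center Q 0 i - side Q / 2), \row_i (center Q 0 i + side Q / 2))%R.

Lemma box_cube_box Q : box (cube_box Q) = cube_set Q.
Proof.
by rewrite predeqE => x; split => h i; have := h i; rewrite /cube_box/= !mxE.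
Qed.

Lemma measurable_cube_set Q : measurable (cube_set Q : set (lebT R n)).
Proof. by rewrite -box_cube_box; exact: measurable_box. Qed.

(** The box covers itself, completed by empty boxes. Conversely, a cover is a pointwise inequality
    of indicators, to which [box_covering_volume] applies with all weights 1. *)
Lemma leb_box (B : E * E) : mu (box B) = (box_vol B)%:E.
Proof.
apply/eqP; rewrite eq_le; apply/andP; split.
  pose C k := if k is 0%N then B else (0, 0)%R : E * E.
  have : box_cover (box B) C by move=> x Bx; exists 0%N.
  move=> /le_leb_cover/le_trans; apply.
  rewrite (nneseries_recl (fun k _ => box_vol_ge0 (C k)) isT).
  rewrite [X in _ + X]eseries0 ?adde0// => -[//|k _ _].
  by rewrite /C /box_vol/= big_ord_recl !mxE subrr maxxx mul0r.
apply: le_ereal_inf_tmp => _ [C BC <-].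
pose f (x : E) (i : nat) := x 0%R (inord i) : R.
have volE (D : E * E) : box_vol D = (1 * \prod_(i < n.+1) Num.max 0 (f D.2 i - f D.1 i))%R.
  by rewrite mul1r; apply: eq_bigr => i _; rewrite /f inord_val.
rewrite volE; under eq_eseriesr do rewrite volE.
apply: (@box_covering_volume _ n.+1 1 (f B.1) (f B.2) (fun=> 1%R)
  (fun k => f (C k).1) (fun k => f (C k).2)) => // x.
pose y : E := \row_i x i.
have indE (D : E * E) : (1 * \prod_(i < n.+1) \1_(`[f D.1 i, f D.2 i[) (x i) = \1_(box D) y :> R)%R.
  rewrite mul1r [RHS]indicE; have [yD|yD] := boolP (y \in box D).
    rewrite big1// => i _; rewrite indicE mem_set//= in_itv/= /f inord_val.
    by have := set_mem yD i; rewrite mxE.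
  move: yD; rewrite notin_setE/= => /existsNP[i] Di.
  rewrite (bigD1 i)//= indicE memNset ?mul0r//= in_itv/= /f inord_val => h.
  by apply: Di; rewrite mxE.
rewrite indE; under eq_eseriesr do rewrite indE.
rewrite indicE; have [yB|yB] := boolP (y \in box B); last first.
  by apply: nneseries_ge0 => k _ _; rewrite lee_fin indicE ler0n.
have [k _ Ck] := BC y (set_mem yB).
apply: (@le_trans _ _ (\sum_(0 <= i < k.+1) (\1_(box (C i)) y)%:E)).
  rewrite big_nat_recr//= [in leRHS]indicE mem_set// leeDr//.
  by apply: sume_ge0 => i _; rewrite lee_fin indicE ler0n.
by apply: nneseries_lim_ge => i _; rewrite lee_fin indicE ler0n.
Qed.

Lemma side_gt0 Q : (0 < side Q)%R. Proof. by rewrite /side. Qed.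

Lemma leb_cube_set Q : mu (cube_set Q) = (side Q ^+ n.+1)%:E.
Proof.
rewrite -box_cube_box leb_box /box_vol; congr EFin.
rewrite (eq_bigr (fun=> side Q)) ?prodr_const ?card_ord// => i _.
by rewrite !mxE (_ : _ - _ = side Q)%R ?max_r ?(ltW (side_gt0 Q))//; field.
Qed.

Lemma box_cover_lt A (c : \bar R) : leb_outer A < c ->
  exists2 B, box_cover A B & \sum_(k <oo) (box_vol (B k))%:E < c.
Proof. by move=> /ereal_inf_lt[_ [B AB <-] Bc]; exists B. Qed.

Lemma loc_integrable_cube (f : E -> R) Q : loc_integrable f ->
  \int[mu]_(x in cube_set Q) `|f x|%:E < +oo.
Proof.
move=> [mf /(_ [set x : E | forall i, `[center Q 0 i - side Q / 2,
  center Q 0 i + side Q / 2]%classic (x 0 i)]%R)].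
have cK := @rV_compact R n.+1 (fun i => `[center Q 0 i - side Q / 2,
  center Q 0 i + side Q / 2]%classic)%R (fun i => @segment_compact R _ _).
move=> /(_ cK); apply: le_lt_trans.
apply: le_integral_lower => // x Qx _; split => // i.
by have /andP[Q1 Q2] := Qx i; rewrite /= in_itv/= Q1 ltW.
Qed.

End lebesgue_cubes.

(** * Dyadic cubes as paths *)

Section dyadic_paths.
Context {R : realType} {n : nat}.
Local Notation E := 'rV[R]_n.+1.
Local Notation center := Defs.center.
Local Notation path := (seq {ffun 'I_n.+1 -> bool}).
Implicit Types (Q P : cube R n) (s t u : path) (x : E) (S : set path).
Local Open Scope ring_scope.

(* The subcube of [Q] reached by the successive choices of [s], the last choice
   being the head of [s]; thus the ancestors of [dcube Q s] are the cubes of the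
   suffixes of [s]. *)
Fixpoint dcube Q s : cube R n := if s is e :: s' then child (dcube Q s') e else Q.

Lemma dyadicP Q P : dyadic Q P <-> exists s, P = dcube Q s.
Proof.
split=> [|[s ->]].
  elim=> [|{}P e _ [s ->]]; first by exists [::].
  by exists (e :: s).
by elim: s => [|e s IH]; [exact: dyadic_refl|exact: dyadic_child].
Qed.

Lemma side_dcube Q s : side (dcube Q s) = side Q / 2 ^+ size s.
Proof.
elim: s => [|e s IH] /=; first by rewrite divr1.
by rewrite {1}/side/= -/(side _) IH exprS invfM mulrA mulrAC.
Qed.

Lemma childE Q e x : cube_set (child Q e) x <->
  forall i, (if e i then center Q 0 i - side Q / 2 <= x 0 i < center Q 0 i
             else center Q 0 i <= x 0 i < center Q 0 i + side Q / 2).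
Proof.
have cE i : center (child Q e) 0 i = center Q 0 i + (-1) ^+ e i * (side Q / 4).
  by rewrite /center/= !mxE.
have sE : side (child Q e) = side Q / 2 by [].
by split => h i; have := h i; rewrite ?cE ?sE; case: (e i);
  rewrite ?expr1 ?expr0 => /andP[? ?]; apply/andP; split; lra.
Qed.

Lemma child_sub Q e : cube_set (child Q e) `<=` cube_set Q.
Proof.
move=> x /childE h i; have := h i; have := side_gt0 Q.
by case: (e i) => s0 /andP[? ?]; apply/andP; split; lra.
Qed.

Lemma child_cover Q x : cube_set Q x -> exists e, cube_set (child Q e) x.
Proof.
move=> Qx; exists [ffun i => x 0 i < center Q 0 i]; apply/childE => i.
by rewrite ffunE; have /andP[-> ->] := Qx i; case: ltP => // ->.
Qed.

Lemma child_inj Q e e' x : cube_set (child Q e) x -> cube_set (child Q e') x ->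
  e = e'.
Proof.
move=> /childE h /childE h'; apply/ffunP => i; have := h i; have := h' i.
by case: (e i) (e' i) => -[]// /andP[? ?] /andP[? ?]; exfalso; lra.
Qed.

Lemma dcube_cat Q s t : dcube Q (s ++ t) = dcube (dcube Q t) s.
Proof. by elim: s => //= e s ->. Qed.

Lemma dcube_sub Q s : cube_set (dcube Q s) `<=` cube_set Q.
Proof. by elim: s => //= e s IH x /child_sub /IH. Qed.

Lemma dcube_sub_cat Q s t : cube_set (dcube Q (s ++ t)) `<=` cube_set (dcube Q t).
Proof. by rewrite dcube_cat; exact: dcube_sub. Qed.

Lemma dcube_cover Q x k : cube_set Q x ->
  exists2 s, size s = k & cube_set (dcube Q s) x.
Proof.
move=> Qx; elim: k => [|k [s sk sx]]; first by exists [::].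
have [e ex] := child_cover sx; exists (e :: s) => //=; by rewrite sk.
Qed.

Lemma dcube_inj_size Q s t x : size s = size t ->
  cube_set (dcube Q s) x -> cube_set (dcube Q t) x -> s = t.
Proof.
elim: s t => [|e s IH] [|e' t]//= [st] sx tx.
have est := IH t st (child_sub sx) (child_sub tx).
by move: tx; rewrite -est => tx; rewrite (child_inj sx tx).
Qed.

(** The ancestor of [s] at the level of [t] also contains [x], and cubes of one level are
    disjoint. *)
Lemma dcube_nested Q s t x : cube_set (dcube Q s) x -> cube_set (dcube Q t) x ->
  (size t <= size s)%N -> exists u, s = u ++ t.
Proof.
move=> sx tx ts; exists (take (size s - size t) s).
rewrite -{1}(cat_take_drop (size s - size t) s); congr (_ ++ _).
apply: (dcube_inj_size (x := x) (Q := Q)) => //.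
  by rewrite size_drop subKn.
by move: sx; rewrite -{1}(cat_take_drop (size s - size t) s) => /dcube_sub_cat.
Qed.

Lemma cube_set_center Q : cube_set Q (center Q).
Proof. by move=> i; have := side_gt0 Q => ?; apply/andP; split; lra. Qed.

(** The maximal cubes of [S]. They are pairwise disjoint and have the same union as [S]. *)
Definition top S : set path :=
  [set s | S s /\ forall u t, s = u ++ t -> S t -> u = [::]].

Lemma top_exists S s : S s -> exists2 t, top S t & exists u, s = u ++ t.
Proof.
move=> Ss; have [k sk] := ubnP (size s); elim: k => // k IH in s Ss sk *.
have [|/existsNP[u /existsNP[t /not_implyP[stu /not_implyP[St u0]]]]] :=
  pselect (forall u t, s = u ++ t -> S t -> u = [::]).
  by exists s => //; exists [::].
have tk : (size t < k)%N.
  move: sk; rewrite stu size_cat ltnS; apply: leq_trans.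
  by rewrite -add1n leq_add2r; case: (u) u0.
have [t' St' [v tv]] := IH _ St tk; exists t' => //; exists (u ++ v).
by rewrite stu tv catA.
Qed.

Lemma bigcup_top Q S :
  \bigcup_(s in S) cube_set (dcube Q s) = \bigcup_(s in top S) cube_set (dcube Q s).
Proof.
apply/seteqP; split => [x [s Ss sx]|x [s [Ss _] sx]]; last by exists s.
by have [t tt [u e]] := top_exists Ss; exists t => //; move: sx; rewrite e => /dcube_sub_cat.
Qed.

Lemma trivIset_top Q S : trivIset (top S) (fun s => cube_set (dcube Q s)).
Proof.
move=> s t [Ss tops] [St topt] [x [sx tx]].
have [st|ts] := leqP (size s) (size t).
  have [u e] := dcube_nested tx sx st; move: (e); rewrite (topt _ _ e Ss).
  by move=> ->.
have [u e] := dcube_nested sx tx (ltnW ts); move: (e); rewrite (tops _ _ e St).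
by move=> ->.
Qed.

Lemma top_parent S e s : top S (e :: s) -> ~ S s.
Proof. by move=> [_ /(_ [:: e] s erefl) h] /h. Qed.

End dyadic_paths.

(** * Weighted masses *)

Section wmass.
Context {R : realType} {n : nat}.
Local Notation E := 'rV[R]_n.+1.
Local Notation mu := (leb R n).
Local Notation meas A := (measurable (A : set (lebT R n))).
Implicit Types (g h : E -> R) (A B : set E) (I : countType) (Q : cube R n).

Lemma wmass_ge0 g A : (forall x, (0 <= g x)%R) -> 0 <= wmass g A.
Proof. by move=> g0; apply: integral_ge0 => x _; rewrite lee_fin. Qed.

Lemma le_wmass g h A B : (forall x, (0 <= g x)%R) -> (forall x, (0 <= h x)%R) ->
  A `<=` B -> (forall x, A x -> (g x <= h x)%R) -> wmass g A <= wmass h B.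
Proof.
move=> g0 h0 AB gh; apply: le_integral_lower => x; rewrite ?lee_fin// => Ax _.
by split; [exact: AB|exact: gh].
Qed.

Lemma wmassS g A B : (forall x, (0 <= g x)%R) -> A `<=` B -> wmass g A <= wmass g B.
Proof. by move=> g0 AB; exact: le_wmass. Qed.

Lemma leb_measurable_cst (c : R) : leb_measurable (fun=> c : R) (n := n).
Proof. exact: measurable_cst. Qed.

Lemma wmass_cst (c : R) A : meas A -> wmass (fun=> c) A = c%:E * mu A.
Proof. by move=> mA; rewrite /wmass integral_cst. Qed.

Lemma wmass_indicE g A : wmass g A = \int[mu]_x (g x * \1_A x)%:E.
Proof.
rewrite /wmass integral_mkcond; apply: eq_integral => x _.
by rewrite patchE indicE; case: ifP => _; rewrite ?mulr1// mulr0.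
Qed.

Lemma wmass_esum g I (S : set I) (A : I -> set E) :
  (forall x, (0 <= g x)%R) -> leb_measurable g -> (forall i, meas (A i)) ->
  \esum_(i in S) wmass g (A i) =
  \int[mu]_x \esum_(i in S) (g x * \1_(A i) x)%:E.
Proof.
move=> g0 mg mA; rewrite (eq_esum (fun i _ => wmass_indicE g (A i))).
apply/esym/(@integral_esum _ (lebT R n) R mu I S
  (fun i (x : lebT R n) => (g x * \1_(A i) x)%:E) setT measurableT).
- by move=> i x; rewrite lee_fin mulr_ge0// indicE ler0n.
- by move=> i; apply/measurable_EFinP; exact: measurable_funM.
Qed.

Lemma esum_indic_trivIset I (S : set I) (A : I -> set E) (c : R) x :
  (0 <= c)%R -> trivIset S A ->
  \esum_(i in S) (c * \1_(A i) x)%:E = (c * \1_(\bigcup_(i in S) A i) x)%:E.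
Proof.
move=> c0 tA; have [|nAx] := pselect ((\bigcup_(i in S) A i) x); last first.
  rewrite esum1; first by rewrite indicE memNset ?mulr0.
  by move=> i Si; rewrite indicE memNset ?mulr0// => Aix; apply: nAx; exists i.
move=> [i Si Aix]; rewrite indicE mem_set; last by exists i.
have c0' j : 0 <= (c * \1_(A j) x)%:E by rewrite lee_fin mulr_ge0// indicE ler0n.
rewrite (esumID [set i])//; have -> : S `&` [set i] = [set i].
  by apply/seteqP; split=> [j []//|j ->].
rewrite esum_set1// [X in _ + X]esum1 ?adde0.
  by rewrite indicE mem_set.
move=> j [Sj ji]; rewrite indicE memNset ?mulr0// => Ajx.
by apply: ji => /=; apply: tA => //; exists x.
Qed.

Lemma wmass_trivIset g I (S : set I) (A : I -> set E) :
  (forall x, (0 <= g x)%R) -> leb_measurable g -> (forall i, meas (A i)) ->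
  trivIset S A -> wmass g (\bigcup_(i in S) A i) = \esum_(i in S) wmass g (A i).
Proof.
move=> g0 mg mA tA; rewrite wmass_esum// wmass_indicE.
by apply: eq_integral => x _; rewrite esum_indic_trivIset.
Qed.

Lemma wmass_bigcup_le g I (S : set I) (A : I -> set E) :
  (forall x, (0 <= g x)%R) -> leb_measurable g -> (forall i, meas (A i)) ->
  wmass g (\bigcup_(i in S) A i) <= \esum_(i in S) wmass g (A i).
Proof.
move=> g0 mg mA; rewrite wmass_esum// wmass_indicE.
have ind0 (B : set E) x : 0 <= (g x * \1_B x)%:E.
  by rewrite lee_fin mulr_ge0// indicE ler0n.
apply: le_integral_lower => // x _; first by apply: esum_ge0.
move=> _; split => //; rewrite [in leLHS]indicE.
have [|_] := boolP (x \in _); last by rewrite mulr0 esum_ge0.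
move=> /set_mem[i Si Aix]; apply: esum_ge; exists [set i].
  by split => // j ->.
by rewrite fsbig_set1 indicE mem_set.
Qed.

(** The overlap bound is integrated against [g]. It serves for the doubles of Whitney cubes, which
    are not disjoint. *)
Lemma esum_wmass_overlap g I (S : set I) (A : I -> set E) (c : R) B :
  (forall x, (0 <= g x)%R) -> leb_measurable g -> (forall i, meas (A i)) ->
  (0 <= c)%R -> meas B ->
  (forall x, \esum_(i in S) (\1_(A i) x)%:E <= (c * \1_B x)%:E) ->
  \esum_(i in S) wmass g (A i) <= c%:E * wmass g B.
Proof.
move=> g0 mg mA c0 mB h.
have ind0 (D : set E) x : 0 <= (g x * \1_D x)%:E.
  by rewrite lee_fin mulr_ge0// indicE ler0n.
rewrite wmass_esum// wmass_indicE.
rewrite -(@ge0_integralZl _ (lebT R n) R mu setT measurableT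
  (fun x => (g x * \1_B x)%:E)); last 3 first.
- by apply/measurable_EFinP; exact: measurable_funM.
- by move=> x _; exact: ind0.
- by [].
apply: le_integral_lower => // [x _|x _|x _ _]; first exact: esum_ge0.
  by rewrite mule_ge0.
split => //; apply: ge_ereal_sup => _ [X [finX XS] <-].
rewrite fsbig_finite//=; under eq_bigr do rewrite EFinM.
rewrite -ge0_sume_distrr => [|i _]; last by rewrite lee_fin indicE ler0n.
rewrite -EFinM mulrCA EFinM; apply: lee_wpmul2l; first by rewrite lee_fin.
by apply: le_trans (h x); apply: ereal_sup_ubound; exists X => //; rewrite fsbig_finite.
Qed.

Lemma wmass_setU g A B : (forall x, (0 <= g x)%R) -> leb_measurable g ->
  meas A -> meas B -> wmass g (A `|` B) <= wmass g A + wmass g B.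
Proof.
move=> g0 mg mA mB; rewrite -bigcup2E.
apply: le_trans (wmass_bigcup_le _ _ _ _) _ => //.
  by move=> [|[|]]//= _; exact: measurable0.
rewrite -nneseries_esumT; last by move=> i; exact: wmass_ge0.
rewrite (nneseries_split _ 2)//; last by move=> k _; exact: wmass_ge0.
rewrite add0n big_mkord !big_ord_recl big_ord0/= adde0 [X in _ + X]eseries0 ?adde0//.
by case => [|[|k]]//= _ _; rewrite /wmass integral_set0.
Qed.

Lemma leb_null_wmass g A : (forall x, (0 <= g x)%R) -> leb_measurable g ->
  meas A -> mu A = 0 -> wmass g A = 0.
Proof.
move=> g0 mg mA A0; rewrite /wmass -(@integral_abs_eq0 _ (lebT R n) R mu A (EFin \o g) mA _ A0).
  by apply: eq_integral => x _; rewrite /= ger0_norm.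
by apply/measurable_EFinP; exact: measurable_funS mg.
Qed.

Lemma wmass_setU_null g A N : (forall x, (0 <= g x)%R) -> leb_measurable g ->
  meas A -> meas N -> mu N = 0 -> wmass g (A `|` N) = wmass g A.
Proof.
move=> g0 mg mA mN N0; apply/eqP; rewrite eq_le; apply/andP; split; last exact: wmassS.
by rewrite (le_trans (wmass_setU _ _ _ _))// (leb_null_wmass g0 mg mN N0) adde0.
Qed.

Lemma measurable_bigcup_countType I (S : set I) (A : I -> set E) :
  (forall i, meas (A i)) -> meas (\bigcup_(i in S) A i).
Proof.
move=> mA; have -> : \bigcup_(i in S) A i =
    \bigcup_k (if @pickle_inv I k is Some i then if i \in S then A i else set0 else set0).
  apply/seteqP; split => [x [i Si Aix]|x [k _]].
    by exists (pickle i) => //; rewrite pickleK_inv mem_set.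
  by case: pickle_inv => // i; case: ifPn => // /set_mem Si Aix; exists i.
apply: bigcupT_measurable => k.
by case: pickle_inv => [i|]; [case: ifP => _|]; rewrite ?measurable0//; exact: mA.
Qed.

Lemma leb_trivIset I (S : set I) (A : I -> set E) : (forall i, meas (A i)) ->
  trivIset S A -> mu (\bigcup_(i in S) A i) = \esum_(i in S) mu (A i).
Proof.
move=> mA tA; have := @wmass_trivIset (fun=> 1%R) I S A.
rewrite wmass_cst ?mul1e; last exact: measurable_bigcup_countType.
move=> /(_ _ (leb_measurable_cst _) mA tA) ->//.
by congr esum; apply/funext => i; rewrite wmass_cst ?mul1e.
Qed.

Lemma leb_bigcup_le I (S : set I) (A : I -> set E) : (forall i, meas (A i)) ->
  mu (\bigcup_(i in S) A i) <= \esum_(i in S) mu (A i).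
Proof.
move=> mA; have := @wmass_bigcup_le (fun=> 1%R) I S A.
rewrite wmass_cst ?mul1e; last exact: measurable_bigcup_countType.
move=> /(_ _ (leb_measurable_cst _) mA)/le_trans; apply => //.
by under eq_esum do rewrite wmass_cst ?mul1e//.
Qed.

Lemma le_leb A B : A `<=` B -> mu A <= mu B.
Proof. exact: le_leb_outer. Qed.

Lemma leb_setU A B : mu (A `|` B) <= mu A + mu B.
Proof. exact: (outer_measureU2 (leb_outer_measure R n)). Qed.

Lemma leb_cube_gt0 Q : 0 < mu (cube_set Q).
Proof. by rewrite leb_cube_set lte_fin exprn_gt0// side_gt0. Qed.

Lemma leb_cube_fin Q : mu (cube_set Q) \is a fin_num.
Proof. by rewrite leb_cube_set. Qed.

Lemma leb_sub_cube_fin A Q : A `<=` cube_set Q -> mu A \is a fin_num.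
Proof.
move=> AQ; rewrite ge0_fin_numE ?leb_outer_ge0//.
by rewrite (le_lt_trans (le_leb AQ))// leb_cube_set ltry.
Qed.

End wmass.

(** * Dyadic stopping and the John-Nirenberg inequality *)

Section dyadic_domination.
Context {R : realType} {n : nat}.
Local Notation E := 'rV[R]_n.+1.
Local Notation mu := (leb R n).
Local Notation meas A := (measurable (A : set (lebT R n))).
Local Notation path := (seq {ffun 'I_n.+1 -> bool}).
Local Notation dc Q s := (cube_set (dcube Q s)).
Implicit Types (f : E -> R) (Q : cube R n) (s : path) (B : E * E).

Lemma measurable_dcubes Q (S : set path) : meas (\bigcup_(s in S) dc Q s).
Proof. by apply: measurable_bigcup_countType => s; exact: measurable_cube_set. Qed.

(** The box is extended below only: a point of a half-open box may lie on a lower face but never on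
    an upper one, so the larger box is a neighbourhood of every point of [box B]. *)
Definition double_box B : E * E := ((B.1 + B.1 - B.2)%R, B.2).

Lemma double_box_vol B : box_vol (double_box B) = (2 ^+ n.+1 * box_vol B)%R.
Proof.
have -> : (2 ^+ n.+1 = \prod_(i < n.+1) 2 :> R)%R by rewrite prodr_const card_ord.
rewrite /box_vol -big_split/=.
apply: eq_bigr => i _; rewrite !mxE.
by rewrite maxr_pMr// mulr0; congr Num.max; ring.
Qed.

Lemma cube_set_dist Q (x y : E) i : cube_set Q x -> cube_set Q y ->
  (x 0 i - side Q < y 0 i < x 0 i + side Q)%R.
Proof.
by move=> /(_ i)/andP[? ?] /(_ i)/andP[? ?]; apply/andP; split; lra.
Qed.

Lemma dcube_small Q (x : E) (delta : R) : cube_set Q x -> (0 < delta)%R ->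
  exists2 s, dc Q s x & (side (dcube Q s) < delta)%R.
Proof.
move=> Qx d0; pose k := Num.bound (side Q / delta).
have [s sk sx] := dcube_cover k Qx; exists s => //.
rewrite side_dcube sk ltr_pdivrMr ?exprn_gt0// mulrC -ltr_pdivrMr//.
exact: upper_nthrootP.
Qed.

Lemma box_dcube Q B (x : E) : cube_set Q x -> box B x ->
  exists2 s, dc Q s x & dc Q s `<=` box (double_box B).
Proof.
move=> Qx Bx.
pose gap i := (Num.min (B.2 0 i - x 0 i) (x 0 i - (B.1 0 i + B.1 0 i - B.2 0 i)))%R.
have gap0 i : (0 < gap i)%R.
  by have /andP[? ?] := Bx i; rewrite /gap lt_min; apply/andP; split; lra.
have [delta d0 dg] : exists2 delta : R, (0 < delta)%R & forall i, (delta <= gap i)%R.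
  exists (\big[Num.min/1%R]_i gap i).
    by elim/big_ind : _ => // u v u0 v0; rewrite lt_min u0.
  by move=> i; rewrite (bigD1 i)//= ge_min lexx.
have [s sx sd] := dcube_small Qx d0; exists s => // y sy i.
have /andP[y1 y2] := cube_set_dist i sx sy.
have := dg i; rewrite /gap le_min => /andP[g1 g2].
by rewrite /double_box/= !mxE; apply/andP; split; lra.
Qed.

(* The factor [2 ^+ n.+2] leaves room for doubling the boxes of a cover of the
   exceptional set, which makes the Lebesgue differentiation theorem
   unnecessary. *)
Lemma dyadic_domination f Q (lam : R) : (forall x, (0 <= f x)%R) ->
  leb_measurable f -> (0 < lam)%R ->
  let N := [set x | [/\ cube_set Q x, (2 ^+ n.+2 * lam <= f x)%R &
    forall s, dc Q s x -> wmass f (dc Q s) <= lam%:E * mu (dc Q s)]] in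
  meas N /\ mu N = 0.
Proof.
move=> f0 mf lam0 N.
have mN : meas N.
  have -> : N = (cube_set Q `&` [set x | (2 ^+ n.+2 * lam <= f x)%R]) `\`
     \bigcup_(s in [set s | ~ (wmass f (dc Q s) <= lam%:E * mu (dc Q s))]) dc Q s.
    apply/seteqP; split => [x [Qx fx h]|x [[Qx fx] h]].
      by split => // -[s /= hs /h].
    by split => // s sx; apply: contrapT => hs; apply: h; exists s.
  apply: measurableD; last exact: measurable_dcubes.
  apply: measurableI; first exact: measurable_cube_set.
  rewrite -[X in meas X]setTI.
  exact: (@measurable_fun_le _ (lebT R n) R setT (cst _) f).
split => //; apply/eqP; rewrite eq_le leb_outer_ge0 andbT leNgt; apply/negP => N0.
have Nfin : mu N \is a fin_num by apply: (@leb_sub_cube_fin _ _ _ Q) => x [].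
(* Three factors are compared: 2 for this cover, [2 ^+ n.+1] for doubling its boxes, and their
   product [2 ^+ n.+2] for the height of [f] on [N]. The maximal dyadic cubes inside the doubled
   boxes cover [N]; each of them meets [N], so the mean of [f] on it is at most [lam]. *)
have [B NB sB] : exists2 B, box_cover N B & \sum_(k <oo) (box_vol (B k))%:E < 2%:E * mu N.
  apply: box_cover_lt; rewrite -[X in X < _]mul1e lte_pmul2r//.
  by rewrite lte_fin ltr1n.
pose S := [set s | (exists k, dc Q s `<=` box (double_box (B k))) /\
                   (dc Q s `&` N !=set0)].
have NS : N `<=` \bigcup_(s in top S) dc Q s.
  rewrite -bigcup_top => x Nx; have [k _ Bx] := NB x Nx; have [Qx _ _] := Nx.
  have [s sx sB'] := box_dcube Qx Bx; exists s => //.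
  by split; [exists k|exists x].
have tS := trivIset_top (Q := Q) (S := S).
have : wmass f N <= lam%:E * mu (\bigcup_(s in top S) dc Q s).
  rewrite -wmass_cst; last exact: measurable_dcubes.
  rewrite (le_trans (wmassS f0 NS))// !wmass_trivIset//;
    try by [move=> ?; exact: measurable_cube_set| move=> ?; exact: ltW | exact: leb_measurable_cst].
  apply: le_esum => s [[_ [x [sx [_ _ h]]]] _].
  by rewrite wmass_cst; [exact: h|exact: measurable_cube_set].
apply/negP; rewrite -ltNge.
apply: (@lt_le_trans _ _ ((2 ^+ n.+2 * lam)%:E * mu N)); last first.
  rewrite -wmass_cst//; apply: le_wmass => //; first by move=> x; rewrite mulr_ge0// ltW.
  by move=> x [].
rewrite mulrC EFinM -muleA lte_pmul2l//.
have : mu (\bigcup_(s in top S) dc Q s) <= \sum_(k <oo) (box_vol (double_box (B k)))%:E.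
  apply: le_leb_cover => x [s [[[k sk] _] _] sx]; exists k => //; exact: sk.
move=> /le_lt_trans; apply.
under eq_eseriesr do rewrite double_box_vol EFinM.
rewrite nneseriesZl; last by move=> k _; exact: box_vol_ge0.
by rewrite (exprSr _ n.+1) EFinM -muleA lte_pmul2l// lte_fin exprn_gt0.
Qed.

End dyadic_domination.

Section stopping_cubes.
Context {R : realType} {n : nat}.
Local Notation E := 'rV[R]_n.+1.
Local Notation mu := (leb R n).
Local Notation path := (seq {ffun 'I_n.+1 -> bool}).
Local Notation dc Q s := (cube_set (dcube Q s)).
Variables (h : E -> R) (Q : cube R n) (lam : R).
Hypothesis h0 : forall x, (0 <= h x)%R.
Hypothesis mh : leb_measurable h.
Hypothesis lam0 : (0 <= lam)%R.

(** The Calderon-Zygmund selection, before restriction to maximal cubes: its union is the set where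
    the dyadic maximal function of [h] relative to [Q] exceeds [lam]. *)
Definition stop : set path :=
  [set s | lam%:E * mu (dc Q s) < wmass h (dc Q s)].

Lemma leb_dcube_cons e s : mu (dc Q s) = (2 ^+ n.+1)%:E * mu (dc Q (e :: s)).
Proof.
rewrite !leb_cube_set -EFinM !side_dcube -exprMn; congr (_ ^+ _)%:E.
by rewrite /= exprS; field; rewrite expf_neq0.
Qed.

(** Weak type (1,1) of the dyadic maximal function: the stopping condition is summed over the
    disjoint maximal cubes. *)
Lemma stop_sum : lam%:E * mu (\bigcup_(s in stop) dc Q s) <=
  wmass h (\bigcup_(s in stop) dc Q s).
Proof.
rewrite bigcup_top -wmass_cst; last exact: measurable_dcubes.
have tS := trivIset_top (Q := Q) (S := stop).
rewrite !wmass_trivIset//;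
  try by [move=> ?; exact: measurable_cube_set | exact: leb_measurable_cst].
apply: le_esum => s [Ss _].
by rewrite wmass_cst; [exact: ltW|exact: measurable_cube_set].
Qed.

(** The parent of a maximal stopping cube is not selected, and its volume is [2 ^+ n.+1] times
    larger. *)
Lemma top_stop_le t : ~ stop [::] -> top stop t ->
  wmass h (dc Q t) <= (2 ^+ n.+1 * lam)%:E * mu (dc Q t).
Proof.
move=> root0; case: t => [[]//|e t /top_parent].
move=> /negP; rewrite -leNgt => ht.
rewrite mulrC EFinM -muleA -(leb_dcube_cons e t); apply: le_trans ht.
by apply: wmassS => //; exact: child_sub.
Qed.

Lemma stop_wmass_le : ~ stop [::] -> wmass h (\bigcup_(s in stop) dc Q s) <=
  (2 ^+ n.+1 * lam)%:E * mu (\bigcup_(s in stop) dc Q s).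
Proof.
move=> root0; rewrite bigcup_top -wmass_cst; last exact: measurable_dcubes.
have tS := trivIset_top (Q := Q) (S := stop).
have l0 : (0 <= 2 ^+ n.+1 * lam)%R by rewrite mulr_ge0.
rewrite !wmass_trivIset//;
  try by [move=> ?; exact: measurable_cube_set | exact: leb_measurable_cst].
apply: le_esum => s ts.
by rewrite wmass_cst; [exact: top_stop_le|exact: measurable_cube_set].
Qed.

End stopping_cubes.

Section john_nirenberg.
Context {R : realType} {n : nat}.
Local Notation E := 'rV[R]_n.+1.
Local Notation mu := (leb R n).
Local Notation meas A := (measurable (A : set (lebT R n))).
Local Notation dc Q s := (cube_set (dcube Q s)).
Implicit Types (Q P : cube R n).

Lemma avgE (g : E -> \bar R) Q :
  avg g Q = (\int[mu]_(x in cube_set Q) g x) * (side Q ^- n.+1)%:E.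
Proof. by rewrite /avg leb_cube_set inver gt_eqF// exprn_gt0// side_gt0. Qed.

Lemma avg_leP (g : E -> \bar R) Q (c : \bar R) :
  (avg g Q <= c) = (\int[mu]_(x in cube_set Q) g x <= c * mu (cube_set Q)).
Proof.
rewrite avgE leb_cube_set; have s0 : (0 < side Q ^+ n.+1)%R by rewrite exprn_gt0// side_gt0.
by rewrite lee_pdivrMr.
Qed.

Variable b : E -> R.
Hypothesis lb : loc_integrable b.

Let mb : leb_measurable b. Proof. exact: lb.1. Qed.

Lemma leb_measurable_dist (c : R) : leb_measurable (fun x => `|b x - c|%R).
Proof.
apply: (measurableT_comp (@normr_measurable R setT)).
by apply: measurable_funB => //; exact: measurable_cst.
Qed.

Lemma dist_mean P (c : R) :
  (`|mean b P - c|)%:E * mu (cube_set P) <= wmass (fun x => `|b x - c|%R) (cube_set P).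
Proof.
have mP := @measurable_cube_set R n P.
have ib : mu.-integrable (cube_set P) (EFin \o b).
  apply/integrableP; split; first by apply/measurable_EFinP; exact: measurable_funS mb.
  exact: loc_integrable_cube.
have ic : mu.-integrable (cube_set P) (EFin \o (fun=> c)).
  apply/integrableP; split; first by apply/measurable_EFinP; exact: measurable_cst.
  rewrite [X in X < _](_ : _ = `|c|%:E * mu (cube_set P)); last by rewrite -integral_cst.
  by rewrite leb_cube_set -EFinM ltry.
have fb := integrable_fin_num mP ib.
have mbc : measurable_fun (cube_set P : set (lebT R n)) (fun x : lebT R n => (b x - c)%:E).
  apply/measurable_EFinP; apply: measurable_funB; last exact: measurable_cst.
  exact: measurable_funS mb.
apply: le_trans (@le_abse_integral _ (lebT R n) R mu _ _ mP mbc).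
have -> : \int[mu]_(x in cube_set P) (b x - c)%:E =
    (\int[mu]_(x in cube_set P) (b x)%:E - c%:E * mu (cube_set P)).
  by rewrite -integral_cst// -integralB_EFin.
pose I := fine (\int[mu]_(x in cube_set P) (b x)%:E).
have IE : \int[mu]_(x in cube_set P) (b x)%:E = I%:E by rewrite fineK.
rewrite /mean avgE IE leb_cube_set -!EFinM/= lee_fin.
have s0 : (0 < side P ^+ n.+1)%R by rewrite exprn_gt0// side_gt0.
rewrite -{2}(gtr0_norm s0) -normrM mulrBl mulfVK// gt_eqF//.
Qed.

Variable B : R.
Hypothesis B0 : (0 < B)%R.
Hypothesis bB : bmo_norm b <= B%:E.

Lemma osc_le Q :
  wmass (fun x => `|b x - mean b Q|%R) (cube_set Q) <= B%:E * mu (cube_set Q).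
Proof.
rewrite /wmass -avg_leP; apply: le_trans bB; apply: ereal_sup_ubound.
by exists Q.
Qed.

(** The step [2 ^+ n.+3 * B] is the height that [dyadic_domination] allows off the stopping cubes of
    height [2 * B]. *)
Definition osc_set (k : nat) Q : set E :=
  [set x | cube_set Q x /\ (k%:R * (2 ^+ n.+3 * B) < `|b x - mean b Q|)%R].

Lemma measurable_osc_set k Q : meas (osc_set k Q).
Proof.
have -> : osc_set k Q = cube_set Q `\`
    ([set: E] `&` [set x | (`|b x - mean b Q| <= k%:R * (2 ^+ n.+3 * B))%R]).
  apply/seteqP; split => [x [Qx bx]|x [Qx bx]]; split => //.
    by move=> [_ /=]; rewrite leNgt bx.
  by rewrite ltNge; apply/negP => h; apply: bx.
apply: measurableD; first exact: measurable_cube_set.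
exact: (@measurable_fun_le _ (lebT R n) R setT _ (cst _) measurableT
  (leb_measurable_dist _) (measurable_cst _)).
Qed.

(** One Calderon-Zygmund selection per level, at height [2 * B]: the selected cubes fill at most
    half of [Q], and passing to one of them changes the mean of [b] by at most [2 ^+ n.+2 * B], half
    a step. *)
Lemma john_nirenberg k Q : mu (osc_set k Q) <= (2 ^- k)%:E * mu (cube_set Q).
Proof.
elim: k Q => [|k IH] Q; first by rewrite expr0 invr1 mul1e; apply: le_leb => x [].
pose h : E -> R := fun x => `|b x - mean b Q|%R; have h0 x : (0 <= h x)%R by exact: normr_ge0.
have mh : leb_measurable h by exact: leb_measurable_dist.
pose lam := (2 * B)%R; have lam0 : (0 < lam)%R by rewrite mulr_gt0.
have [mN N0] := dyadic_domination Q h0 mh lam0.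
set N := [set x | _] in mN N0; pose S := stop h Q lam.
have root0 : ~ S [::].
  rewrite /S/stop/=; apply/negP; rewrite -leNgt (le_trans (osc_le Q))//.
  by apply: lee_wpmul2r => //; rewrite lee_fin /lam; move: B0; lra.
have sub : osc_set k.+1 Q `<=` (\bigcup_(s in top S) osc_set k (dcube Q s)) `|` N.
  move=> x [Qx bx]; have [|nS] := pselect ((\bigcup_(s in S) dc Q s) x).
    rewrite bigcup_top => -[t tt tx]; left; exists t => //; split => //.
    have := dist_mean (dcube Q t) (mean b Q).
    move=> /le_trans /(_ (top_stop_le h0 root0 tt)).
    rewrite lee_pmul2r ?leb_cube_fin ?leb_cube_gt0// lee_fin.
    have := ler_distD (mean b (dcube Q t)) (b x) (mean b Q).
    rewrite /lam; move: bx; rewrite (exprS _ n.+2) (exprS _ n.+1) -natr1.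
    have : (0 < 2 ^+ n.+1 * B)%R by rewrite mulr_gt0// exprn_gt0.
    by move: (2 ^+ n.+1)%R => c; lra.
  (* Off the selected cubes, the oscillation exceeds a full step only on the null set [N]. *)
  right; split => //.
    apply: le_trans (ltW bx); rewrite /lam (exprS _ n.+2).
    have c0 : (0 <= 2 ^+ n.+2 * B)%R by rewrite mulr_ge0 ?exprn_ge0// ltW.
    have k1 : (1 <= k.+1%:R :> R)%R by rewrite ler1n.
    by have := ler_wpM2l c0 k1; move: (2 ^+ n.+2)%R k.+1%:R => c K; lra.
  by move=> s sx; rewrite leNgt; apply/negP => Ss; apply: nS; exists s.
apply: (le_trans (le_leb sub)).
apply: (le_trans (leb_setU _ _)); rewrite N0 adde0.
apply: (le_trans (@leb_bigcup_le R n _ (top S) (fun s => osc_set k (dcube Q s))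
  (fun s => measurable_osc_set k (dcube Q s)))).
apply: (@le_trans _ _ ((2 ^- k)%:E * mu (\bigcup_(s in S) dc Q s))).
  rewrite bigcup_top -wmass_cst; last exact: measurable_dcubes.
  rewrite wmass_trivIset//.
  - by apply: le_esum => s ts; rewrite wmass_cst; [exact: IH|exact: measurable_cube_set].
  - exact: leb_measurable_cst.
  - by move=> s; exact: measurable_cube_set.
  - exact: trivIset_top.
have : lam%:E * mu (\bigcup_(s in S) dc Q s) <= B%:E * mu (cube_set Q).
  apply: (le_trans (stop_sum Q h0 mh (ltW lam0))); apply: le_trans (osc_le Q).
  by apply: wmassS => // x [s _] /dcube_sub.
have Ufin : mu (\bigcup_(s in S) dc Q s) \is a fin_num.
  by apply: (@leb_sub_cube_fin _ _ _ Q) => x [s _] /dcube_sub.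
rewrite -(fineK Ufin) -(fineK (leb_cube_fin Q)) -!EFinM !lee_fin.
move: (fine _) (fine _) => u q; rewrite /lam (mulrC _ B) -mulrA ler_pM2l// => uq.
by rewrite exprSr invfM -mulrA ler_pM2l ?invr_gt0 ?exprn_gt0//; lra.
Qed.

End john_nirenberg.

(** * Generalized Hoelder inequality in L log L *)

Section llogl.
Context {R : realType} {n : nat}.
Local Notation E := 'rV[R]_n.+1.
Local Notation mu := (leb R n).
Implicit Types (Q P : cube R n) (f : E -> R).

Lemma geometric_esum_le (c q : R) : (0 <= c)%R -> (0 <= q < 1)%R ->
  \esum_(k in [set: nat]) (c * q ^+ k)%:E <= (c / (1 - q))%:E.
Proof.
move=> c0 /andP[q0 q1]; have t0 k : 0 <= (c * q ^+ k)%:E by rewrite lee_fin mulr_ge0// exprn_ge0.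
rewrite -nneseries_esumT//; apply: lime_le; first exact: is_cvg_nneseries.
apply: nearW => N; rewrite sumEFin lee_fin big_mkord -mulr_sumr ler_wpM2l//.
have q1' : (0 < 1 - q)%R by lra.
rewrite -(ler_pM2r q1') mulVf ?gt_eqF//.
rewrite (_ : _ * _ = 1 - q ^+ N)%R ?lerBlDr ?lerDl ?exprn_ge0//.
by rewrite -[RHS]opprB subrX1; ring.
Qed.

Lemma phi_ge (t : R) : (0 <= t)%R -> (t <= phi t)%R.
Proof.
move=> t0; rewrite /phi -{1}(mulr1 t) ler_wpM2l// -[leLHS](expRK 1%R).
by rewrite ler_ln ?posrE ?expR_gt0 ?lerDl// ltr_wpDr ?expR_gt0.
Qed.

Lemma measurable_phi_comp f (lam : R) : leb_measurable f ->
  leb_measurable (fun x => phi (`|f x| / lam))%R.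
Proof.
move=> mf; have mg : leb_measurable (fun x => `|f x| / lam)%R.
  apply: measurable_funM; last exact: measurable_cst.
  exact: (measurableT_comp (@normr_measurable R setT)).
apply: (measurable_funM mg); apply: (measurableT_comp (@measurable_ln R)).
by apply: (measurable_funD _ mg); exact: measurable_cst.
Qed.

(** Since [t <= phi t], every [lam] admissible in the norm bounds the mean. *)
Lemma avg_le_LlogL f Q : leb_measurable f ->
  avg (fun x => `|f x|%:E) Q <= LlogL_norm f Q.
Proof.
move=> mf; apply: le_ereal_inf_tmp => _ [lam [lam0 hlam] <-].
rewrite avg_leP; move: hlam; rewrite avg_leP mul1e => hlam.
rewrite -lee_pdivrMl//; apply: le_trans hlam.
rewrite -(@ge0_integralZl _ (lebT R n) R mu _ (@measurable_cube_set R n Q)); last 3 first.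
- apply/measurable_EFinP; apply: (measurableT_comp (@normr_measurable R setT)).
  exact: measurable_funS mf.
- by move=> x _; rewrite lee_fin.
- by rewrite lee_fin invr_ge0 ltW.
apply: le_integral_lower => x Qx.
- by rewrite -EFinM lee_fin mulr_ge0// invr_ge0 ltW.
- by rewrite lee_fin (le_trans _ (phi_ge _))// mulr_ge0// invr_ge0 ltW.
- by move=> _; split => //; rewrite -EFinM lee_fin mulrC phi_ge// mulr_ge0// invr_ge0 ltW.
Qed.

(** Chosen so that the exponential of twice this number is [3 / 2]: the growth per level stays below
    2, the John-Nirenberg decay per level. *)
Definition young_rate : R := (ln (3 / 2) / 2)%R.
Local Notation a := young_rate.
Local Notation r := (3 / 2 : R)%R.
Let a0 : (0 < a)%R. Proof. by rewrite divr_gt0// ln_gt0//; lra. Qed.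
Let exp2a : expR (2 * a) = (3 / 2)%R :> R.
Proof. by rewrite /young_rate mulrC divfK// lnK// posrE; lra. Qed.

Let a1 : (0 < 3 / (2 * a))%R.
Proof. by apply: divr_gt0 => //; exact: mulr_gt0. Qed.

Let aE : (3 / (2 * a) = 3 / 2 * a^-1)%R.
Proof. by field; rewrite gt_eqF. Qed.

(* Where [v] is of order [k * theta], which by John-Nirenberg happens on a
   proportion [2 ^- k] of the cube, [v * g] is controlled by [phi g] or by
   [(3 / 2) ^+ k], and the latter is summable against [2 ^- k]. *)
Lemma young_levels (v g theta : R) (k : nat) : (0 <= v)%R -> (0 <= g)%R ->
  (0 < theta)%R -> (v <= k.+1%:R * theta)%R ->
  (v * g <= 3 / (2 * a) * theta * (phi g + r ^+ k))%R.
Proof.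
move=> v0 g0 th0 vk; have e0 : (0 < expR 1 + g :> R)%R by rewrite ltr_wpDr ?expR_gt0.
have phi0 : (0 <= phi g)%R by exact: le_trans (phi_ge g0).
have r0 : (0 <= r ^+ k :> R)%R by rewrite exprn_ge0.
have vg : (v * g <= theta * (k.+1%:R * g))%R.
  by rewrite mulrA (mulrC theta) ler_wpM2r.
apply: (le_trans vg); rewrite (mulrC _ theta) -mulrA ler_pM2l//.
have [h|h] := leP (a * k.+1%:R)%R (ln (expR 1 + g)).
  apply: (@le_trans _ _ (a^-1 * phi g)%R).
    by rewrite ler_pdivlMl// /phi mulrA mulrC ler_wpM2l.
  have ai : (0 < a^-1)%R by rewrite invr_gt0.
  rewrite aE; have : (0 <= a^-1 * phi g)%R by rewrite mulr_ge0// ltW.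
  have : (0 <= a^-1 * r ^+ k)%R by rewrite mulr_ge0// ltW.
  by move: (a^-1)%R (phi g) (r ^+ k)%R => *; lra.
(* The logarithm is small here: [g] and [k.+1] are both at most a multiple of [expR (a * k.+1%:R)],
   whose square is [(3 / 2) ^+ k.+1]. *)
have gk : (g <= expR (a * k.+1%:R))%R.
  have : (expR 1 + g < expR (a * k.+1%:R))%R by rewrite -ltr_expR lnK in h.
  by have := expR_gt0 (1 : R); lra.
have kk : (k.+1%:R <= a^-1 * expR (a * k.+1%:R))%R.
  by rewrite ler_pdivlMl// (le_trans _ (expR_ge1Dx _))// lerDr.
apply: (@le_trans _ _ (a^-1 * expR (a * k.+1%:R) * expR (a * k.+1%:R))%R).
  by rewrite ler_pM.
rewrite -mulrA -expRD (_ : a * k.+1%:R + a * k.+1%:R = k.+1%:R * (2 * a))%R; last by ring.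
rewrite expRM_natl exp2a exprS aE.
have : (0 <= a^-1 * phi g)%R by rewrite mulr_ge0// invr_ge0 ltW.
by move: (a^-1)%R (phi g) (r ^+ k)%R => *; lra.
Qed.

(** Places an oscillation between two consecutive levels; the lower inequality is strict to match
    [osc_set]. *)
Lemma level_exists (v theta : R) : (0 < v)%R -> (0 < theta)%R ->
  exists2 k : nat, (k%:R * theta < v)%R & (v <= k.+1%:R * theta)%R.
Proof.
move=> v0 th0; pose P m := (v <= m%:R * theta)%R.
have exP : exists m, P m.
  by exists (Num.bound (v / theta)); rewrite /P -ler_pdivrMr// ltW// archi_boundP// divr_ge0 ?ltW.
case: (ex_minnP exP) => -[|k] Pk mk; first by move: Pk; rewrite /P mul0r leNgt v0.
by exists k => //; rewrite ltNge; apply/negP => /mk; rewrite ltnn.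
Qed.

(** [3 / (2 * a)] comes from [young_levels] and [2 ^+ n.+3] is the John-Nirenberg step over [B]. In
    5 = 1 + 4, the 1 bounds the mean of [phi], and 4 is the sum of [(3 / 2) ^+ k] against
    [2 ^- k]. *)
Definition hoelder_const : R := (3 / (2 * a) * 2 ^+ n.+3 * 5)%R.

Lemma hoelder_const_gt0 : (0 < hoelder_const)%R.
Proof. by apply: mulr_gt0 => //; apply: mulr_gt0 => //; exact: exprn_gt0. Qed.

(** The norm is an infimum, so it is enough to treat each admissible [lam]; for it, the pointwise
    bound of [young_levels] is integrated over [Q]. *)
Lemma LlogL_hoelder (b : E -> R) (B : R) f Q :
  loc_integrable b -> (0 < B)%R -> bmo_norm b <= B%:E -> leb_measurable f ->
  avg (fun y => `|(b y - mean b Q) * f y|%:E) Q <=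
  (hoelder_const * B)%:E * LlogL_norm f Q.
Proof.
move=> lb B0 bB mf; have CB0 : (0 < hoelder_const * B)%R by rewrite mulr_gt0// hoelder_const_gt0.
rewrite -lee_pdivrMl//; apply: le_ereal_inf_tmp => _ [lam [lam0 hlam] <-].
rewrite lee_pdivrMl// -EFinM avg_leP.
move: hlam; rewrite avg_leP mul1e => hlam.
have mQ := @measurable_cube_set R n Q.
pose theta := (2 ^+ n.+3 * B)%R; have th0 : (0 < theta)%R by rewrite mulr_gt0// exprn_gt0.
pose A := (3 / (2 * a) * theta)%R.
have A0 : (0 < A)%R by exact: mulr_gt0.
(* At a point whose oscillation is on level [k], this sum contains the term [r ^+ k] of
   [young_levels]. By John-Nirenberg its mean over [Q] is at most the sum of [(3 / 4) ^+ k], which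
   is 4. *)
pose h (x : E) := \esum_(k in [set: nat]) (r ^+ k * \1_(osc_set b B k Q) x)%:E.
have hk0 k (x : E) : 0 <= (r ^+ k * \1_(osc_set b B k Q) x)%:E.
  by rewrite lee_fin mulr_ge0// ?exprn_ge0// indicE ler0n.
have mhk k : measurable_fun (cube_set Q : set (lebT R n))
    (fun x : lebT R n => (r ^+ k * \1_(osc_set b B k Q) x)%:E).
  apply/measurable_EFinP; apply: measurable_funM => //.
  apply: measurable_indic; exact: (measurable_osc_set lb).
have h0 x : 0 <= h x by apply: esum_ge0.
have phi0 x : 0 <= (phi (`|f x| / lam))%:E.
  by rewrite lee_fin (le_trans _ (phi_ge _))// mulr_ge0// invr_ge0 ltW.
have mphi : measurable_fun (cube_set Q : set (lebT R n))
    (fun x : lebT R n => (phi (`|f x| / lam))%:E).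
  by apply/measurable_EFinP; apply: measurable_funS (measurable_phi_comp lam mf).
have mh : measurable_fun (cube_set Q : set (lebT R n)) h.
  exact: (@measurable_esum _ (lebT R n) R).
have hint : \int[mu]_(x in cube_set Q) h x <= 4%:E * mu (cube_set Q).
  rewrite (@integral_esum _ (lebT R n) R mu)//.
  apply: (@le_trans _ _ (\esum_(k in [set: nat]) ((side Q ^+ n.+1) * (3 / 4) ^+ k)%:E)).
    apply: le_esum => k _.
    rewrite (_ : \int[mu]_(x in _) _ = (r ^+ k)%:E * mu (osc_set b B k Q)).
      apply: (@le_trans _ _ ((r ^+ k)%:E * ((2 ^- k)%:E * mu (cube_set Q)))).
        by apply: lee_wpmul2l; [rewrite lee_fin exprn_ge0|exact: john_nirenberg].
      rewrite leb_cube_set -!EFinM lee_fin mulrCA mulrA mulrC -exprVn -exprMn.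
      by rewrite (_ : 2^-1 * (3 / 2) = 3 / 4 :> R)%R//; field.
    rewrite -wmass_cst; last exact: (measurable_osc_set lb).
    rewrite wmass_indicE integral_mkcond; apply: eq_integral => x _.
    rewrite patchE; case: ifPn => //; rewrite notin_setE => nQ.
    by rewrite indicE memNset ?mulr0// => -[].
  rewrite leb_cube_set -EFinM; apply: (le_trans (geometric_esum_le _ _)).
  - by rewrite exprn_ge0// ltW// side_gt0.
  - by apply/andP; split; lra.
  - by rewrite lee_fin (_ : 1 - 3 / 4 = 4^-1 :> R)%R ?invrK 1?mulrC//; field.
apply: (@le_trans _ _ ((A * lam)%:E *
  (\int[mu]_(x in cube_set Q) ((phi (`|f x| / lam))%:E + h x)))); last first.
  rewrite (@ge0_integralD _ (lebT R n) R mu)//.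
  apply: (@le_trans _ _ ((A * lam)%:E * (mu (cube_set Q) + 4%:E * mu (cube_set Q)))).
    by apply: lee_wpmul2l; [rewrite lee_fin mulr_ge0// ltW|exact: leeD].
  rewrite leb_cube_set -!EFinM -?EFinD -?EFinM lee_fin /hoelder_const /A /theta.
  by rewrite le_eqVlt; apply/orP; left; apply/eqP; ring.
rewrite -(@ge0_integralZl _ (lebT R n) R mu _ mQ
  (fun x => (phi (`|f x| / lam))%:E + h x)); last 3 first.
- exact: (emeasurable_funD mphi mh).
- by move=> x _; rewrite adde_ge0.
- by rewrite lee_fin mulr_ge0// ltW.
apply: le_integral_lower => [x _|x _|x Qx _]; first by rewrite lee_fin.
  by rewrite mule_ge0// ?adde_ge0// lee_fin mulr_ge0// ltW.
split => //; rewrite normrM; set v := `|b x - _|%R.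
have [v0|v0] := eqVneq v 0%R.
  by rewrite v0 mul0r mule_ge0// ?adde_ge0// lee_fin mulr_ge0// ltW.
have {}v0 : (0 < v)%R by rewrite lt_neqAle eq_sym v0 normr_ge0.
have [k k1 k2] := level_exists v0 th0.
apply: (@le_trans _ _ ((A * lam)%:E * ((phi (`|f x| / lam))%:E + (r ^+ k)%:E))).
  rewrite -EFinD -EFinM lee_fin.
  have g0 : (0 <= `|f x| / lam)%R by rewrite mulr_ge0// invr_ge0 ltW.
  have := ler_wpM2l (ltW lam0) (young_levels (ltW v0) g0 th0 k2); rewrite -/A.
  rewrite (_ : lam * (v * (`|f x| / lam)) = v * `|f x|)%R; last by field; rewrite gt_eqF.
  by rewrite mulrA (mulrC lam).
apply: lee_wpmul2l; first by rewrite lee_fin mulr_ge0// ltW.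
apply: leeD => //; apply: esum_ge; exists [set k] => //.
by rewrite fsbig_set1 lee_fin indicE mem_set ?mulr1.
Qed.

End llogl.

(** * Quantitative weak A-infinity decay *)

Section weak_decay.
Context {R : realType} {n : nat}.
Local Notation E := 'rV[R]_n.+1.
Local Notation mu := (leb R n).
Local Notation meas A := (measurable (A : set (lebT R n))).
Local Notation dc Q s := (cube_set (dcube Q s)).
Local Notation center := Defs.center.
Local Notation dil r Q := (cube_set (dilate (r%:pos)%R Q)).
Implicit Types (Q P : cube R n).

Lemma cube_subset P Q : (forall i, (center Q 0 i - side Q / 2 <= center P 0 i - side P / 2)%R /\
   (center P 0 i + side P / 2 <= center Q 0 i + side Q / 2)%R) ->
  cube_set P `<=` cube_set Q.
Proof.
move=> h x Px i; have /andP[? ?] := Px i; have [? ?] := h i.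
by apply/andP; split; lra.
Qed.

Lemma sub_dilate2 Q : cube_set Q `<=` dil 2 Q.
Proof.
apply: cube_subset => i; have := side_gt0 Q.
by rewrite /dilate /center /side/=; split; lra.
Qed.

Variable w : E -> R.
Hypothesis w0 : forall x, (0 <= w x)%R.
Hypothesis lw : loc_integrable w.

Let mw : leb_measurable w. Proof. exact: lw.1. Qed.

Lemma wmass_cube_fin Q : wmass w (cube_set Q) \is a fin_num.
Proof.
rewrite ge0_fin_numE ?wmass_ge0//; apply: le_lt_trans (loc_integrable_cube Q lw).
by apply: le_integral_lower => [x _|x _|x Qx _]; rewrite ?lee_fin// ger0_norm.
Qed.

Variable K : R.
Hypothesis hK : weak_Ainfty_const w <= K%:E.

Definition decay (s kap : R) := forall Q (A : set E), meas A -> A `<=` cube_set Q ->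
  mu A <= s%:E * mu (cube_set Q) -> wmass w A <= kap%:E * wmass w (dil 2 Q).

Lemma maximal_int_le Q :
  \int[mu]_(x in cube_set Q) maximal (fun y => w y * \1_(cube_set Q) y)%R x <=
  K%:E * wmass w (dil 2 Q).
Proof.
set I := integral _ _ _; have : I / wmass w (dil 2 Q) <= K%:E.
  by apply: le_trans hK; apply: ereal_sup_ubound; exists Q.
rewrite -(fineK (wmass_cube_fin _)); set y := fine _.
(* A positive [I] divided by 0 gives [+oo], so the finite bound [K] forces [I] to vanish. *)
have [->|y0] := eqVneq y 0%R.
  rewrite inve0 mule0; case: (ltP 0 I) => // I0.
  by rewrite gt0_muley// leye_eq.
have yp : (0 < y)%R by rewrite lt_neqAle eq_sym y0 fine_ge0// wmass_ge0.
by rewrite inver (negbTE y0) lee_pdivrMr.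
Qed.

Lemma maximal_dcube Q s x (lam : R) : dc Q s x ->
  lam%:E * mu (dc Q s) < wmass w (dc Q s) ->
  lam%:E <= maximal (fun y => w y * \1_(cube_set Q) y)%R x.
Proof.
move=> sx /ltW h.
apply: (@le_trans _ _ (avg (fun y => `|w y * \1_(cube_set Q) y|%:E) (dcube Q s))).
  rewrite avgE lee_pdivlMr ?exprn_gt0 ?side_gt0// -leb_cube_set.
  apply: (le_trans h); apply: le_integral_lower => [y _|y _|y sy _]; rewrite ?lee_fin//.
  by split => //; rewrite indicE mem_set ?mulr1 ?ger0_norm//; exact: dcube_sub sy.
by apply: ereal_sup_ubound; exists (dcube Q s).
Qed.

(** The first term bounds the mass of [A] off the superlevel set [Om N], where almost everywhere [w]
    is at most [2 ^+ (n.+2 + N)] times its mean over [Q]. The second bounds the mass of [Om N],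
    which is contained in [N] superlevel sets whose masses add up to at most [2 ^+ n.+2 * K] times
    the mass of the double. *)
Lemma decay_base (N : nat) (s : R) : (0 < N)%N -> (0 <= s)%R -> (0 <= K)%R ->
  decay s (2 ^+ (n.+2 + N) * s + 2 ^+ n.+2 * K / N%:R).
Proof.
move=> N0 s0 K0 Q A mA AQ As.
have Wfin := wmass_cube_fin Q.
have WW2 : wmass w (cube_set Q) <= wmass w (dil 2 Q).
  by apply: wmassS => //; exact: sub_dilate2.
have W20 : 0 <= wmass w (dil 2 Q) by exact: wmass_ge0.
have c1 : (0 <= 2 ^+ (n.+2 + N) * s)%R by rewrite mulr_ge0// exprn_ge0.
have c2 : (0 <= 2 ^+ n.+2 * K / N%:R)%R by rewrite divr_ge0// mulr_ge0// exprn_ge0.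
(* The levels below are multiples of the mean of [w] over [Q], which has to be positive. *)
have [W0|W0] := eqVneq (wmass w (cube_set Q)) 0.
  apply: (@le_trans _ _ 0); first by rewrite -W0; exact: wmassS.
  by rewrite mule_ge0// lee_fin addr_ge0.
pose q := (side Q ^+ n.+1)%R; have q0 : (0 < q)%R by rewrite exprn_gt0// side_gt0.
pose om := (fine (wmass w (cube_set Q)) / q)%R.
have WE : wmass w (cube_set Q) = (om * q)%:E by rewrite divfK ?gt_eqF// fineK.
have om0 : (0 < om)%R.
  rewrite -(pmulr_lgt0 _ q0) -lte_fin -WE lt_neqAle eq_sym W0; exact: wmass_ge0.
pose lam i := (2 ^+ i * om)%R; have lam0 i : (0 < lam i)%R by rewrite mulr_gt0// exprn_gt0.
pose Om i := \bigcup_(s in stop w Q (lam i)) dc Q s.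
have mOm i : meas (Om i) by exact: measurable_dcubes.
have OmQ i : Om i `<=` cube_set Q by move=> x [t _] /dcube_sub.
have root0 i : ~ stop w Q (lam i) [::].
  apply/negP; rewrite -leNgt -[dcube Q [::]]/Q WE leb_cube_set -EFinM lee_fin ler_wpM2r ?(ltW q0)//.
  by rewrite ler_peMl ?(ltW om0)// exprn_ege1// ler1n.
have OmS i : Om N `<=` Om i \/ (N < i)%N.
  have [iN|] := leqP i N; [left|by right].
  move=> x [t ht tx]; exists t => //.
  apply: le_lt_trans ht; apply: lee_wpmul2r; first exact: leb_outer_ge0.
  by rewrite lee_fin ler_wpM2r ?(ltW om0)// ler_weXn2l// ler1n.
have Wom i : wmass w (Om i) <= (2 ^+ n.+1 * lam i)%:E * mu (Om i).
  exact: (stop_wmass_le w0 mw (ltW (lam0 i)) (root0 i)).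
(* The levels are geometric: if [x] is in the last set, the halved levels sum to at most [lam M], a
   lower bound for the maximal function at [x]; otherwise the last term vanishes. *)
have point M x : cube_set Q x ->
    (\sum_(i < M) lam i / 2 * \1_(Om i) x)%:E <=
    maximal (fun y => w y * \1_(cube_set Q) y)%R x.
  move=> Qx; have max0 : 0 <= maximal (fun y => w y * \1_(cube_set Q) y)%R x.
    apply: (@le_trans _ _ (avg (fun y => `|w y * \1_(cube_set Q) y|%:E) Q)).
      by rewrite avgE mule_ge0 ?integral_ge0// lee_fin// invr_ge0 exprn_ge0// ltW// side_gt0.
    by apply: ereal_sup_ubound; exists Q.
  elim: M => [|M IH]; first by rewrite big_ord0.
  have [Mx|Mx] := pselect (Om M x); last first.
    by rewrite big_ord_recr/= [X in (_ + _ * X)%R]indicE memNset// mulr0 addr0.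
  have [t ht tx] := Mx; apply: le_trans (maximal_dcube tx ht).
  rewrite lee_fin; apply: (@le_trans _ _ (\sum_(i < M.+1) lam i / 2)%R).
    by apply: ler_sum => i _; rewrite ler_piMr ?divr_ge0 ?(ltW (lam0 _)).
  have -> : (\sum_(i < M.+1) lam i / 2 = om / 2 * \sum_(i < M.+1) 2 ^+ i)%R.
    by rewrite mulr_sumr; apply: eq_bigr => i _; rewrite /lam; ring.
  have := subrX1 (2 : R) M.+1; rewrite (_ : 2 - 1 = 1 :> R)%R ?mul1r; last by ring.
  move=> <-; rewrite exprS /lam; have := om0.
  by move: (2 ^+ M)%R => c; lra.
have sumOm : \sum_(i < N) (lam i / 2)%:E * mu (Om i) <= K%:E * wmass w (dil 2 Q).
  apply: le_trans (maximal_int_le Q).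
  have -> : \sum_(i < N) (lam i / 2)%:E * mu (Om i) =
      \int[mu]_(x in cube_set Q) (\sum_(i < N) (lam i / 2 * \1_(Om i) x)%:E).
    rewrite (@ge0_integral_sum _ (lebT R n) R mu _ (@measurable_cube_set R n Q) _
      (fun (i : 'I_N) x => (lam i / 2 * \1_(Om i) x)%:E)).
    - apply: eq_bigr => i _; rewrite -wmass_cst// wmass_indicE integral_mkcond.
      apply: eq_integral => x _; rewrite patchE; case: ifPn => //.
      by rewrite notin_setE => nQ; rewrite indicE memNset ?mulr0// => /OmQ.
    - move=> i; apply/measurable_EFinP; apply: measurable_funM; first exact: measurable_cst.
      exact: measurable_indic.
    - by move=> i x _; rewrite lee_fin mulr_ge0 ?divr_ge0 ?(ltW (lam0 _))// indicE ler0n.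
  apply: le_integral_lower => [x _|x Qx|x Qx _].
  - apply: sume_ge0 => i _.
    by rewrite lee_fin mulr_ge0 ?divr_ge0 ?(ltW (lam0 _))// indicE ler0n.
  - by apply: le_trans (point 0%N x Qx); rewrite big_ord0.
  - by split => //; rewrite sumEFin; exact: point.
have WOmN : wmass w (Om N) <= (2 ^+ n.+2 * K / N%:R)%:E * wmass w (dil 2 Q).
  have : N%:R%:E * wmass w (Om N) <= (2 ^+ n.+2 * K)%:E * wmass w (dil 2 Q).
    rewrite EFinM -muleA; apply: le_trans (lee_wpmul2l _ sumOm); last by rewrite lee_fin exprn_ge0.
    rewrite ge0_sume_distrr; last first.
      by move=> i _; rewrite mule_ge0 ?leb_outer_ge0// lee_fin divr_ge0// ltW.
    apply: (@le_trans _ _ (\sum_(i < N) wmass w (Om i))).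
      rewrite (_ : N%:R%:E * _ = \sum_(i < N) wmass w (Om N)).
        apply: lee_sum => i _; apply: wmassS => //.
        by have [//|] := OmS i; rewrite ltnNge ltnW.
      have Ofin : wmass w (Om N) \is a fin_num.
        rewrite ge0_fin_numE ?wmass_ge0//; apply: le_lt_trans (wmassS w0 (OmQ N)) _.
        by rewrite WE ltry.
      by rewrite -(fineK Ofin) sumEFin -EFinM sumr_const card_ord mulr_natl.
    apply: lee_sum => i _; apply: le_trans (Wom i) _.
    rewrite muleA -EFinM; apply: lee_wpmul2r => //.
    by rewrite lee_fin le_eqVlt; apply/orP; left; apply/eqP; rewrite (exprS _ n.+1); field.
  have Nr : (0 < N%:R :> R)%R by rewrite ltr0n.
  rewrite -lee_pdivlMl// muleA -EFinM => h; apply: (le_trans h).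
  by rewrite mulrC.
(* Off [Om N], the weight reaches [2 ^+ n.+2 * lam N] only on a null set. *)
have [mN N0'] := dyadic_domination Q w0 mw (lam0 N).
set Z := [set x | _] in mN N0'.
have WA' : wmass w (A `\` Om N) <= (2 ^+ (n.+2 + N) * s)%:E * wmass w (dil 2 Q).
  apply: (@le_trans _ _ (wmass w (((A `\` Om N) `\` Z) `|` Z))).
    apply: wmassS => // x Ax; have [|nZ] := pselect (Z x); [by right|by left].
  rewrite wmass_setU_null//; last first.
    by apply: measurableD => //; exact: measurableD.
  apply: (@le_trans _ _ (wmass (fun=> 2 ^+ n.+2 * lam N)%R A)).
    apply: le_wmass => //.
    - by move=> x; rewrite mulr_ge0 ?exprn_ge0// ltW.
    - by move=> x [[]].
    move=> x [[Ax nOm] nZ]; rewrite leNgt; apply/negP => h; apply: nZ; split.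
    - exact: AQ.
    - exact: ltW.
    - by move=> t tx; rewrite leNgt; apply/negP => ht; apply: nOm; exists t.
  rewrite wmass_cst//.
  apply: (@le_trans _ _ ((2 ^+ n.+2 * lam N)%:E * (s%:E * mu (cube_set Q)))).
    by apply: lee_wpmul2l => //; rewrite lee_fin mulr_ge0 ?exprn_ge0// ltW.
  apply: (@le_trans _ _ ((2 ^+ (n.+2 + N) * s)%:E * wmass w (cube_set Q))).
    rewrite WE leb_cube_set -/q -!EFinM lee_fin exprD /lam.
    by rewrite le_eqVlt; apply/orP; left; apply/eqP; ring.
  by apply: lee_wpmul2l => //; rewrite lee_fin mulr_ge0 ?exprn_ge0.
apply: (@le_trans _ _ (wmass w ((A `\` Om N) `|` Om N))).
  by apply: wmassS => // x Ax; have [|nO] := pselect (Om N x); [by right|by left].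
apply: (le_trans (wmass_setU _ _ _ _)) => //; first exact: measurableD.
rewrite EFinD ge0_muleDl ?lee_fin//.
exact: leeD.
Qed.

End weak_decay.

(** * Dilated dyadic cubes and a Whitney decomposition *)

Section dilated_dyadic_cubes.
Context {R : realType} {n : nat}.
Local Notation E := 'rV[R]_n.+1.
Local Notation mu := (leb R n).
Local Notation path := (seq {ffun 'I_n.+1 -> bool}).
Local Notation dc Q s := (cube_set (dcube Q s)).
Local Notation center := Defs.center.
Local Notation dil r Q := (cube_set (dilate (r%:pos)%R Q)).
Implicit Types (Q P : cube R n) (s t p : path).

Lemma dilP (r : {posnum R}) Q x : cube_set (dilate r Q) x <-> forall i,
  (center Q 0 i - r%:num * side Q / 2 <= x 0 i < center Q 0 i + r%:num * side Q / 2)%R.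
Proof. by []. Qed.

Lemma center_child Q e i :
  (center Q 0 i - side Q / 4 <= center (child Q e) 0 i <= center Q 0 i + side Q / 4)%R.
Proof.
have -> : (center (child Q e) 0 i = center Q 0 i + (-1) ^+ e i * (side Q / 4))%R.
  by rewrite /center/= !mxE.
by have := side_gt0 Q; case: (e i); rewrite ?expr1 ?expr0 => ?; apply/andP; split; lra.
Qed.

Lemma side_child Q e : side (child Q e) = (side Q / 2)%R. Proof. by []. Qed.

Lemma leb_dil (r : {posnum R}) Q :
  mu (cube_set (dilate r Q)) = (r%:num ^+ n.+1)%:E * mu (cube_set Q).
Proof. by rewrite !leb_cube_set -EFinM -exprMn. Qed.

Lemma side_le_subset P Q : cube_set P `<=` cube_set Q -> (side P <= side Q)%R.
Proof.
move=> /le_leb; rewrite !leb_cube_set lee_fin.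
by rewrite ler_pXn2r// nnegrE ltW// side_gt0.
Qed.

Lemma dil3_child Q e : dil 3 (child Q e) `<=` dil 3 Q.
Proof.
move=> x /dilP h; apply/dilP => i; have := h i; have := center_child Q e i.
rewrite side_child /= => /andP[? ?] /andP[? ?]; have := side_gt0 Q => ?.
by apply/andP; split; lra.
Qed.

Lemma dil3_cat Q s t : dil 3 (dcube Q (s ++ t)) `<=` dil 3 (dcube Q t).
Proof. by elim: s => //= e s IH x /dil3_child /IH. Qed.

(** In units of the side of [Q], the centre moves by [1 / 4] and the new half-side is 1, together
    less than [3 / 2]. *)
Lemma dil4_child Q e : dil 4 (child Q e) `<=` dil 3 Q.
Proof.
move=> x /dilP h; apply/dilP => i; have := h i; have := center_child Q e i.
rewrite side_child /= => /andP[? ?] /andP[? ?]; have := side_gt0 Q => ?.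
by apply/andP; split; lra.
Qed.

Lemma dil_sub (r r' : {posnum R}) Q : (r%:num <= r'%:num)%R ->
  cube_set (dilate r Q) `<=` cube_set (dilate r' Q).
Proof.
move=> rr x /dilP h; apply/dilP => i; have := h i; have := side_gt0 Q => s0.
have := ler_wpM2r (ltW s0) rr => ? /andP[? ?].
by apply/andP; split; lra.
Qed.

(** A point of [dil 4 Q'] is within [1 / 2 + 1 / 4 + 2 = 11 / 4] sides of [Q'] from [x], the side of
    [Q] exceeds 3 of these, and [x] is within one side of [Q] from its centre. *)
Lemma dil4_parent_sub (Q Q' : cube R n) e x : (6 * side (child Q' e) < side Q)%R ->
  dil 2 Q x -> dil 2 (child Q' e) x -> dil 4 Q' `<=` dil 4 Q.
Proof.
rewrite side_child => sQ /dilP h /dilP h' y /dilP hy; apply/dilP => i.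
have := h i; have := h' i; have := hy i; have := center_child Q' e i.
have := side_gt0 Q'; rewrite side_child /= => ? /andP[? ?] /andP[? ?] /andP[? ?] /andP[? ?].
by apply/andP; split; lra.
Qed.

Section whitney.
Variables (Q : cube R n) (S : set path).

(* Cubes well inside the neighbourhood [dil 3 (dcube Q p)] of a cube of [S]; the
   maximal ones form a Whitney-type decomposition, so that their doubles have
   bounded overlap. *)
Definition whitney : set path :=
  [set s | exists2 p, S p & dil 4 (dcube Q s) `<=` dil 3 (dcube Q p)].

Definition halo : set E := \bigcup_(p in S) dil 3 (dcube Q p).

Lemma whitney_cons e p : S p -> whitney (e :: p).
Proof. by move=> Sp; exists p => //; exact: dil4_child. Qed.

(** If [t] were much smaller than its neighbour [s], the fourfold dilation of the parent of [t]
    would lie in that of [s]; the parent would be in [whitney], against the maximality of [t]. *)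
Lemma whitney_side s t x : top whitney s -> top whitney t ->
  (forall p, S p -> (size p > 0)%N) ->
  dil 2 (dcube Q s) x -> dil 2 (dcube Q t) x ->
  (side (dcube Q s) <= 6 * side (dcube Q t))%R.
Proof.
move=> ts tt S0 sx tx; rewrite leNgt; apply/negP => st.
have [p Sp hp] := ts.1.
case: t tt tx st => [|e t] tt tx st.
  have : (side (dcube Q s) <= side Q)%R by apply: side_le_subset; exact: dcube_sub.
  by have := side_gt0 Q; move: st => /=; lra.
apply: (top_parent tt); exists p => //.
by apply: subset_trans hp; exact: dil4_parent_sub st sx tx.
Qed.

(** Volume count: the cubes whose doubles contain [x] are disjoint, have sides at least [sg / 6] for
    the side [sg] of one of them, and lie in a cube of side [19 * sg] about [x]; and
    [114 = 6 * 19]. *)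
Lemma whitney_overlap x : (forall p, S p -> (size p > 0)%N) ->
  \esum_(t in top whitney) (\1_(dil 2 (dcube Q t)) x : R)%:E <=
  (114 ^+ n.+1 * \1_halo x : R)%:E.
Proof.
move=> S0.
have [[t0 tt0 xt0]|nt] := pselect (exists2 t, top whitney t & dil 2 (dcube Q t) x); last first.
  rewrite esum1; first by rewrite lee_fin mulr_ge0// ?exprn_ge0// indicE ler0n.
  by move=> t tt; rewrite indicE memNset// => xt; apply: nt; exists t.
have -> : \1_halo x = 1%R :> R.
  rewrite indicE mem_set//; have [p Sp hp] := tt0.1; exists p => //; apply: hp.
  by apply: dil_sub xt0 => /=; rewrite ler_nat.
rewrite mulr1.
pose sg := side (dcube Q t0); have sg0 : (0 < sg)%R by exact: side_gt0.
pose c := ((6 / sg) ^+ n.+1)%R.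
have c0 : (0 <= c)%R by rewrite exprn_ge0// divr_ge0// ltW.
have [J JE] : exists J : set path, forall t, J t <-> dil 2 (dcube Q t) x.
  by exists [set t | dil 2 (dcube Q t) x].
have -> : \esum_(t in top whitney) (\1_(dil 2 (dcube Q t)) x : R)%:E =
    \esum_(t in top whitney `&` J) (1%:E : \bar R).
  rewrite [RHS]esum_mkcondr; apply: eq_esum => t _; rewrite indicE.
  have [h|h] := boolP (t \in J); first by rewrite mem_set//; apply/JE; exact: set_mem h.
  by rewrite memNset//; move: h; rewrite notin_setE JE.
(* A cube of side at most [6 * sg] whose double contains [x] stays within [9 * sg] of [x], less than
   half of [19 * sg]. *)
have B0 : (0 < 19 * sg)%R by rewrite mulr_gt0.
pose B : cube R n := (x, PosNum B0).
have side_t t : (top whitney `&` J) t -> (sg <= 6 * side (dcube Q t))%R /\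
    (side (dcube Q t) <= 6 * sg)%R.
  move=> [tt /JE xt]; split; first exact: (whitney_side tt0 tt S0 xt0 xt).
  exact: (whitney_side tt tt0 S0 xt xt0).
apply: (@le_trans _ _ (\esum_(t in top whitney `&` J) wmass (fun=> c) (dc Q t))).
  apply: le_esum => t Jt; have [s1 _] := side_t t Jt.
  rewrite wmass_cst; last exact: measurable_cube_set.
  rewrite leb_cube_set -EFinM lee_fin -exprMn exprn_ege1// mulrAC.
  by rewrite ler_pdivlMr// mul1r.
rewrite -wmass_trivIset//.
- apply: (@le_trans _ _ (wmass (fun=> c) (cube_set B))).
    apply: wmassS => // y [t Jt ty] i; have [_ s2] := side_t t Jt.
    have /andP[? ?] := ty i; have /JE/dilP/(_ i)/andP[/= ? ?] := Jt.2.
    by rewrite /B /center /side/=; apply/andP; split; lra.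
  rewrite wmass_cst; last exact: measurable_cube_set.
  rewrite leb_cube_set -EFinM lee_fin -exprMn /side/=.
  by rewrite (_ : 6 / sg * (19 * sg) = 114)%R//; field; rewrite gt_eqF.
- exact: leb_measurable_cst.
- by move=> t; exact: measurable_cube_set.
- by apply: sub_trivIset (@trivIset_top R n Q whitney) => t [].
Qed.

End whitney.

End dilated_dyadic_cubes.

(** * Composition of two decay estimates *)

Section decay_step.
Context {R : realType} {n : nat}.
Local Notation E := 'rV[R]_n.+1.
Local Notation mu := (leb R n).
Local Notation meas A := (measurable (A : set (lebT R n))).
Local Notation path := (seq {ffun 'I_n.+1 -> bool}).
Local Notation dc Q s := (cube_set (dcube Q s)).
Local Notation center := Defs.center.
Local Notation dil r Q := (cube_set (dilate (r%:pos)%R Q)).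
Local Notation dbl Q := (dilate (2%:pos)%R Q).
Implicit Types (Q P : cube R n) (s t p : path).

Lemma esum_finType_le (I : finType) (a : I -> \bar R) (c : R) : (0 <= c)%R ->
  (forall i, a i <= c%:E) -> \esum_(i in [set: I]) a i <= (#|I|%:R * c)%:E.
Proof.
move=> c0 ac; apply: ge_ereal_sup => _ [X [finX _] <-]; rewrite fsbig_finite//=.
apply: (@le_trans _ _ (\sum_(i <- finmap.enum_fset (fset_set X)) c%:E)).
  by apply: lee_sum => i _.
rewrite sumEFin lee_fin big_const_seq count_predT iter_addr_0 -[leLHS]mulr_natl.
rewrite ler_wpM2r// ler_nat; have /card_uniqP <- := finmap.fset_uniq (fset_set X).
exact: max_card.
Qed.

Lemma wmass_indic (A B : set E) : meas A -> meas B -> wmass \1_A B = mu (A `&` B).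
Proof. by move=> mA mB; rewrite /wmass integral_indic. Qed.

Lemma wmassZ (k : R) (g : E -> R) B : (0 <= k)%R -> (forall x, (0 <= g x)%R) ->
  leb_measurable g -> meas B -> wmass (fun x => k * g x)%R B = k%:E * wmass g B.
Proof.
move=> k0 g0 mg mB; rewrite /wmass -(@ge0_integralZl _ (lebT R n) R mu _ mB
  (EFin \o g))//; last by move=> x _; rewrite lee_fin.
by apply/measurable_EFinP; exact: measurable_funS mg.
Qed.

Variable w : E -> R.
Hypothesis w0 : forall x, (0 <= w x)%R.
Hypothesis lw : loc_integrable w.

Let mw : leb_measurable w. Proof. exact: lw.1. Qed.

(** In [192 = 3 * 4 * 16], 3 stands for the neighbourhood [dil 3], 4 for the two generations between
    a Whitney cube and an ancestor where [A] is thin, and 16 for cutting the neighbourhood into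
    cubes of side [q / 16]. In the mass factor, 114 is the overlap of the Whitney doubles and 32 the
    number of small cubes along an edge of the double of [Q]. *)
Lemma decay_step (s1 s2 k1 k2 : R) : (0 < s1 <= 1)%R -> (0 < s2 <= 1)%R ->
  (0 <= k1)%R -> (0 <= k2)%R -> decay w s1 k1 -> decay w s2 k2 ->
  decay w (s1 * s2 / 192 ^+ n.+1) (114 ^+ n.+1 * 32 ^+ n.+1 * k1 * k2).
Proof.
move=> /andP[s10 s11] /andP[s20 s21] k10 k20 D1 D2 Q A mA AQ hA.
pose f : E -> R := \1_A; have f0 x : (0 <= f x)%R by rewrite /f indicE ler0n.
have mf : leb_measurable f by exact: measurable_indic.
have e4 : (0 < 4 ^+ n.+1 :> R)%R by rewrite exprn_gt0.
(* With this threshold, [A] has density at most [s2] in every grandchild of a cube that is not a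
   stopping cube. *)
pose tau := (s2 / 4 ^+ n.+1)%R.
have tau0 : (0 < tau)%R by rewrite divr_gt0.
pose S := stop f Q tau; pose q := side Q; have q0 : (0 < q)%R by exact: side_gt0.
have SE p : S p -> tau%:E * mu (dc Q p) < mu A.
  move=> /lt_le_trans; apply; rewrite wmass_indic//; last exact: measurable_cube_set.
  by apply: le_leb => x [].
(* Stopping cubes are small because [A] is: sides at most [q / 4] keep their triples well inside the
   double of [Q]. *)
have hS p : S p -> (1 < size p)%N.
  move=> /SE h; rewrite ltnNge; apply/negP => p1; move: h; apply/negP; rewrite -leNgt.
  apply: (le_trans hA); rewrite !leb_cube_set -!EFinM lee_fin side_dcube -/q.
  apply: (@le_trans _ _ (tau * (q / 2) ^+ n.+1)%R).
    rewrite (_ : 192 = 24 * (4 * 2) :> R)%R; last by ring.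
    rewrite /tau !exprMn exprVn.
    have : (0 < 2 ^+ n.+1 :> R)%R by rewrite exprn_gt0.
    have : (1 <= 24 ^+ n.+1 :> R)%R by rewrite exprn_ege1// ler1n.
    have : (0 < q ^+ n.+1)%R by rewrite exprn_gt0.
    move: (4 ^+ n.+1)%R e4 (2 ^+ n.+1)%R (24 ^+ n.+1)%R (q ^+ n.+1)%R => X X0 Y Z U U0 Z1 Y0.
    have Z0 : (0 < Z)%R by exact: lt_le_trans Z1.
    rewrite (_ : _ * U = s1 / Z * (s2 / X * (U / Y)))%R; last first.
      by field; rewrite !gt_eqF.
    rewrite ler_piMl//; first by rewrite mulr_ge0// divr_ge0// ltW.
    by rewrite ler_pdivrMr// mul1r (le_trans s11).
  rewrite ler_wpM2l ?(ltW tau0)// ler_pXn2r ?nnegrE ?divr_ge0 ?exprn_ge0 ?(ltW q0)//.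
  rewrite ler_wpM2l ?(ltW q0)// lef_pV2 ?posrE ?exprn_gt0//.
  by rewrite -[leRHS]expr1 ler_weXn2l// ler1n.
have S0 p : S p -> (0 < size p)%N by move=> /hS; exact: ltnW.
have Sside p : S p -> (side (dcube Q p) <= q / 4)%R.
  move=> /hS p1; rewrite side_dcube ler_wpM2l ?(ltW q0)// lef_pV2 ?posrE ?exprn_gt0//.
  by rewrite (_ : 4 = 2 ^+ 2 :> R)%R ?ler_weXn2l ?ler1n//; ring.
have [mN N0] := dyadic_domination Q f0 mf tau0.
set N := [set x | _] in mN N0; pose Wh := whitney Q S.
pose Om := halo Q S.
have mOm : meas Om by apply: measurable_bigcup_countType => p; exact: measurable_cube_set.
have tsize t : top Wh t -> (side (dcube Q t) < q / 2)%R.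
  move=> [[p Sp /side_le_subset hp] _]; have := Sside p Sp; move: hp.
  by rewrite {1 2}/side/= -!/(side _); have := q0; lra.
have cover : A `<=` (\bigcup_(t in top Wh) (A `&` dc Q t)) `|` N.
  move=> x Ax; have [[p Sp px]|nS] := pselect ((\bigcup_(p in S) dc Q p) x).
    left; have [e ex] := child_cover px.
    have : (\bigcup_(t in Wh) dc Q t) x by exists (e :: p) => //; exact: whitney_cons.
    by rewrite bigcup_top => -[t tt tx]; exists t.
  right; split; first exact: AQ.
    (* Here [2 ^+ n.+2 * tau <= 1], so that a point of [A] in no stopping cube falls into the null
       set [N]. *)
    rewrite /f indicE mem_set// mulrA ler_pdivrMr// mul1r.
    rewrite (_ : 4 = 2 * 2 :> R)%R; last by ring.
    rewrite exprMn (exprS _ n.+1); apply: (@le_trans _ _ (2 * 2 ^+ n.+1 * 1)%R).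
      by rewrite ler_wpM2l// mulr_ge0// exprn_ge0.
    by rewrite mulr1 ler_wpM2r ?exprn_ge0// -[leLHS]expr1 ler_weXn2l// ler1n.
  by move=> p px; rewrite leNgt; apply/negP => Sp; apply: nS; exists p.
have pieces t : top Wh t -> wmass w (A `&` dc Q t) <= k2%:E * wmass w (dil 2 (dcube Q t)).
  move=> tt; apply: D2; [|by move=> x []|].
    by apply: measurableI => //; exact: measurable_cube_set.
  case: t tt (tsize t tt) => [|e [|e' t]] tt.
  - by rewrite /= -/q => ?; exfalso; have := q0; lra.
  - by rewrite [side _](_ : _ = q / 2)%R// ltxx.
  (* Now [t] is the grandparent of the Whitney cube. Were it a stopping cube, its child [e' :: t]
     would be in [whitney], against the maximality of [e :: e' :: t]. *)
  move=> _; have nS : ~ S t.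
    by move=> St; apply: (top_parent tt); exact: whitney_cons.
  apply: (@le_trans _ _ (mu (A `&` dc Q t))).
    by apply: le_leb => x [Ax /child_sub /child_sub tx].
  rewrite -wmass_indic//; last exact: measurable_cube_set.
  apply: (@le_trans _ _ (tau%:E * mu (dc Q t))).
    by rewrite leNgt; apply/negP => St; apply: nS.
  rewrite (leb_dcube_cons Q e') (leb_dcube_cons Q e) !muleA -!EFinM.
  apply: lee_wpmul2r; first exact: leb_outer_ge0.
  rewrite lee_fin /tau -mulrA -exprMn (_ : 2 * 2 = 4 :> R)%R; last by ring.
  by rewrite divfK ?gt_eqF.
have WA : wmass w A <= (114 ^+ n.+1 * k2)%:E * wmass w Om.
  apply: le_trans (wmassS w0 cover) _; rewrite wmass_setU_null//; last first.
    apply: measurable_bigcup_countType => t; apply: measurableI => //.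
    exact: measurable_cube_set.
  apply: (le_trans (wmass_bigcup_le _ _ _ _)) => //.
    by move=> t; apply: measurableI => //; exact: measurable_cube_set.
  have g0 x : (0 <= k2 * w x)%R by rewrite mulr_ge0.
  have mg : leb_measurable (fun x => k2 * w x)%R.
    by apply: measurable_funM => //; exact: measurable_cst.
  rewrite EFinM -muleA -wmassZ//.
  have c0 : (0 <= 114 ^+ n.+1 :> R)%R by rewrite exprn_ge0.
  apply: (le_trans _ (esum_wmass_overlap g0 mg (fun t => measurable_cube_set _)
    c0 mOm (fun x => @whitney_overlap R n Q S x S0))).
  apply: le_esum => t tt; rewrite wmassZ//; first exact: pieces.
  exact: measurable_cube_set.
(* Tripling costs [3 ^+ n.+1], and by [stop_sum] the stopping cubes have total measure at most that
   of [A] over [tau]. *)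
have mOmle : mu Om <= (s1 / 16 ^+ n.+1)%:E * mu (cube_set Q).
  have OmE : Om `<=` \bigcup_(p in top S) dil 3 (dcube Q p).
    by move=> x [p Sp px]; have [t tt [u e]] := top_exists Sp; exists t => //;
       move: px; rewrite e => /dil3_cat.
  apply: (le_trans (le_leb OmE)); apply: (le_trans (leb_bigcup_le _ _)).
    by move=> p; exact: measurable_cube_set.
  apply: (@le_trans _ _ ((3 ^+ n.+1)%:E * mu (\bigcup_(p in top S) dc Q p))).
    rewrite -wmass_cst; last exact: measurable_dcubes.
    rewrite wmass_trivIset//.
    - apply: le_esum => p _; rewrite wmass_cst; last exact: measurable_cube_set.
      by rewrite leb_dil.
    - exact: leb_measurable_cst.
    - by move=> p; exact: measurable_cube_set.
    - exact: trivIset_top.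
  rewrite -bigcup_top.
  have : tau%:E * mu (\bigcup_(p in S) dc Q p) <= mu A.
    apply: (le_trans (stop_sum Q f0 mf (ltW tau0))).
    rewrite wmass_indic//; last exact: measurable_dcubes.
    by apply: le_leb => x [].
  move=> /le_trans /(_ hA).
  rewrite muleC -lee_pdivlMr// => h.
  apply: (le_trans (lee_wpmul2l _ h)); first by rewrite lee_fin exprn_ge0.
  rewrite leb_cube_set -!EFinM lee_fin /tau -/q le_eqVlt; apply/orP; left; apply/eqP.
  rewrite (_ : 192 = 3 * 4 * 16 :> R)%R; last by ring.
  rewrite !exprMn; field; rewrite !expf_neq0 ?gt_eqF//.
(* At most [q / 2] to the centre of the stopping cube, plus [3 / 8 * q] for half the side of its
   triple. *)
have OmQ x : Om x -> forall i, (center Q 0 i - 7 / 8 * q <= x 0 i <= center Q 0 i + 7 / 8 * q)%R.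
  move=> [p Sp /dilP px] i; have /=/andP[? ?] := px i; have := Sside p Sp => ?.
  have := dcube_sub (cube_set_center (dcube Q p)); move=> /(_ i) /andP[].
  by rewrite /= -/q => ? ?; apply/andP; split; lra.
have sQ2 r : size r = 5%N -> side (dcube (dbl Q) r) = (q / 16)%R.
  by move=> r5; rewrite side_dcube r5 {1}/side/= -/(side Q) -/q; field.
(* If a cube of side [q / 16] meets [Om], its double reaches no further than [7 / 8 + 3 / 32 < 1]
   times [q] from the centre of [Q], hence stays in the double of [Q]. *)
have part r : size r = 5%N -> wmass w (Om `&` dc (dbl Q) r) <= k1%:E * wmass w (dil 2 Q).
  move=> r5; have W20 : 0 <= k1%:E * wmass w (dil 2 Q) by rewrite mule_ge0// wmass_ge0.
  have [[x [Ox rx]]|nO] := pselect ((Om `&` dc (dbl Q) r) !=set0); last first.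
    rewrite (_ : _ `&` _ = set0) /wmass ?integral_set0//.
    by rewrite predeqE => x; split => // hx; apply: nO; exists x.
  apply: (@le_trans _ _ (k1%:E * wmass w (dil 2 (dcube (dbl Q) r)))).
    apply: D1; [|by move=> y []|].
      by apply: measurableI => //; exact: measurable_cube_set.
    apply: (@le_trans _ _ (mu Om)); first by apply: le_leb => y [].
    apply: (le_trans mOmle); rewrite !leb_cube_set (sQ2 _ r5) -/q -!EFinM lee_fin.
    by rewrite expr_div_n mulrA mulrAC.
  apply: lee_wpmul2l; rewrite ?lee_fin//; apply: wmassS => // y /dilP hy.
  apply/dilP => i; have /andP[? ?] := OmQ x Ox i.
  have := hy i; rewrite (sQ2 _ r5) /= => /andP[? ?].
  have /andP[] := rx i; rewrite (sQ2 _ r5) /= -/q => ? ?.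
  by have := side_gt0 Q; rewrite -/q => ?; apply/andP; split; lra.
have WOm : wmass w Om <= (32 ^+ n.+1 * k1)%:E * wmass w (dil 2 Q).
  pose I := (5.-tuple {ffun 'I_n.+1 -> bool})%type.
  have W2fin : wmass w (dil 2 Q) \is a fin_num by exact: wmass_cube_fin.
  have OmI : Om `<=` \bigcup_(r in [set: I]) (Om `&` dc (dbl Q) r).
    move=> x Ox; have : dil 2 Q x.
      apply/dilP => i; have /andP[? ?] := OmQ x Ox i.
      by rewrite /= -/q; apply/andP; split; lra.
    move=> /(dcube_cover 5)[r /eqP r5 rx]; exists (Tuple r5) => //.
  apply: (le_trans (wmassS w0 OmI)).
  apply: (le_trans (wmass_bigcup_le _ _ _ _)) => //.
    by move=> r; apply: measurableI => //; exact: measurable_cube_set.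
  have W20 : (0 <= fine (wmass w (dil 2 Q)))%R by rewrite fine_ge0// wmass_ge0.
  rewrite -(fineK W2fin) -EFinM.
  have -> : (32 ^+ n.+1 * k1 * fine (wmass w (dil 2 Q)) =
      #|{: I}|%:R * (k1 * fine (wmass w (dil 2 Q))))%R.
    rewrite card_tuple card_ffun card_bool card_ord -mulrA; congr (_ * _)%R.
    by rewrite -!natrX; congr (_%:R); rewrite -expnM mulnC expnM.
  apply: esum_finType_le; first by rewrite mulr_ge0.
  by move=> r; rewrite EFinM fineK//; apply: part; rewrite size_tuple.
apply: (le_trans WA).
have c0 : 0 <= (114 ^+ n.+1 * k2)%:E by rewrite lee_fin mulr_ge0// exprn_ge0.
apply: (le_trans (lee_wpmul2l c0 WOm)); rewrite muleA -EFinM.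
apply: lee_wpmul2r; first exact: wmass_ge0.
by rewrite lee_fin le_eqVlt; apply/orP; left; apply/eqP; ring.
Qed.

End decay_step.

(** * Iteration of the decay estimate *)

Section decay_exponential.
Context {R : realType} {n : nat}.
Local Notation E := 'rV[R]_n.+1.
Local Notation dil r Q := (cube_set (dilate (r%:pos)%R Q)).
Implicit Types (Q : cube R n) (w : E -> R).

Lemma decay_mono w (s s' k k' : R) : (forall x, (0 <= w x)%R) ->
  (s' <= s)%R -> (k <= k')%R -> decay w s k -> decay w s' k'.
Proof.
move=> w0 ss kk D Q A mA AQ As.
apply: (@le_trans _ _ (k%:E * wmass w (dil 2 Q))).
  apply: D => //; apply: (le_trans As); apply: lee_wpmul2r; first exact: leb_outer_ge0.
  by rewrite lee_fin.
by apply: lee_wpmul2r; [exact: wmass_ge0|rewrite lee_fin].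
Qed.

Lemma decay_trivial w : (forall x, (0 <= w x)%R) -> decay w 1 1.
Proof.
move=> w0 Q A mA AQ _; rewrite mul1e; apply: wmassS => //.
by apply: (subset_trans AQ); exact: sub_dilate2.
Qed.

(** Collects the exponents chosen in [decay_exp]: the first summand is the part of [L] independent
    of [K], with one unit for rounding [N]; the second is the factor of [K]. *)
Definition decay_rate : R := ((n + 5 + 20 * n.+1)%:R + 2 ^+ (n.+2 + 2) * 2 ^+ (12 * n.+1))%R.

Lemma decay_rate_ge1 : (1 <= decay_rate)%R.
Proof.
have : (0 <= 2 ^+ (n.+2 + 2) * 2 ^+ (12 * n.+1) :> R)%R by rewrite mulr_ge0// exprn_ge0.
have : (1 <= (n + 5 + 20 * n.+1)%:R :> R)%R by rewrite ler1n addn_gt0 addn_gt0 orbT.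
by rewrite /decay_rate; lra.
Qed.

(** Each use of [decay_step] loses a factor at most [D = 2 ^+ (12 * n.+1)] in mass. The base
    estimate is therefore taken with factor [D^-1 / 2], and the induction keeps a spare [D^-1]. *)
Lemma decay_exp w (K : R) : (forall x, (0 <= w x)%R) -> loc_integrable w ->
  (0 <= K)%R -> weak_Ainfty_const w <= K%:E ->
  exists L : nat, [/\ (0 < L)%N, (L%:R <= decay_rate * (K + 1))%R &
    forall k : nat, decay w (2 ^- (L * k)) (2 ^- k)].
Proof.
have LE (i j : nat) : (i.+2 + j + 2 + 12 * i.+1 + 8 * i.+1 = i + 4 + 20 * i.+1 + j)%N by lia.
move=> w0 lw K0 hK; pose D : R := (2 ^+ (12 * n.+1))%R.
have D0 : (0 < D)%R by rewrite exprn_gt0.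
have D1 : (1 <= D)%R by rewrite exprn_ege1// ler1n.
have D12 : (114 ^+ n.+1 * 32 ^+ n.+1 <= D)%R.
  rewrite /D (_ : (12 = 7 + 5)%N)// mulnDl exprD !exprM ler_pM ?exprn_ge0//.
    by rewrite ler_pXn2r ?nnegrE ?exprn_ge0// -natrX ler_nat.
  by rewrite ler_pXn2r ?nnegrE ?exprn_ge0// -natrX ler_nat.
have DE : (2 ^+ (12 * n.+1) = D :> R)%R by [].
clearbody D.
pose x : R := (2 ^+ (n.+2 + 2) * D * K)%R.
have x0 : (0 <= x)%R by rewrite mulr_ge0// mulr_ge0 ?exprn_ge0 ?(ltW D0).
(* [N] brings the maximal function term of [decay_base] below [D^-1 / 4], and [M] then does the same
   for the other term. *)
pose N := (Num.truncn x).+1.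
have xN : (x <= N%:R)%R by rewrite ltW// truncnS_gt.
have Nx : (N%:R <= x + 1)%R by rewrite /N -natr1 lerD2r truncn_le.
have N0 : (0 < N%:R :> R)%R by rewrite ltr0n.
pose M := (n.+2 + N + 2 + 12 * n.+1)%N.
(* The extra [8 * n.+1] absorbs the factor [192 ^+ n.+1] of each step. *)
pose L := (M + 8 * n.+1)%N.
pose s0 : R := (2 ^- M)%R.
have s00 : (0 < s0)%R by rewrite invr_gt0 exprn_gt0.
have s01 : (s0 <= 1)%R by rewrite invf_le1 ?exprn_gt0// exprn_ege1// ler1n.
have D8 : (192 ^+ n.+1 <= 2 ^+ (8 * n.+1) :> R)%R.
  rewrite exprM ler_pXn2r ?nnegrE ?exprn_ge0//.
  by rewrite -natrX ler_nat.
have Dinv : (0 < D^-1)%R by rewrite invr_gt0.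
have base : decay w s0 (D^-1 / 2).
  apply: (decay_mono w0 (lexx _) _ (decay_base w0 lw hK (isT : (0 < N)%N) (ltW s00) K0)).
  have e1 : (2 ^+ (n.+2 + N) * s0 <= D^-1 / 4)%R.
    rewrite /s0 /M -addnA (exprD _ (n.+2 + N)) invfM mulrA divff ?expf_neq0//.
    rewrite mul1r exprD DE invfM mulrC (_ : 2 ^+ 2 = 4 :> R)%R//; ring.
  have e2 : (2 ^+ n.+2 * K / N%:R <= D^-1 / 4)%R.
    rewrite ler_pdivrMr// -(ler_pM2l D0) mulrA.
    apply: (le_trans (_ : _ <= x / 4)%R).
      rewrite /x (exprD _ n.+2) le_eqVlt; apply/orP; left; apply/eqP; by field.
    by rewrite !mulrA mulfV ?gt_eqF// mul1r mulrC ler_wpM2l.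
  by lra.
have iter k : decay w (2 ^- (L * k.+1)) (2 ^- k.+1 / D).
  elim: k => [|k IH].
    apply: decay_mono base => //.
      rewrite muln1 lef_pV2 ?posrE ?exprn_gt0// ler_weXn2l ?ler1n//.
      by rewrite leq_addr.
    by rewrite expr1 mulrC.
  have p1 : (0 < (2 ^- (L * k.+1) : R) <= 1)%R.
    by rewrite invr_gt0 exprn_gt0//= invf_le1 ?exprn_gt0// exprn_ege1// ler1n.
  have p2 : (0 < s0 <= 1)%R by rewrite s00.
  apply: decay_mono (decay_step w0 lw p1 p2 _ _ IH base) => //.
  - rewrite mulnS addnC exprD invfM -mulrA ler_wpM2l ?invr_ge0 ?exprn_ge0//.
    rewrite /L exprD invfM ler_wpM2l ?(ltW s00)// lef_pV2 ?posrE ?exprn_gt0//.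
  - apply: (@le_trans _ _ (D * (2 ^- k.+1 / D) * (D^-1 / 2))%R).
      do 2 (apply: ler_wpM2r; first by rewrite ?mulr_ge0 ?invr_ge0 ?exprn_ge0 ?(ltW D0)).
      exact: D12.
    rewrite (exprS _ k.+1) invfM le_eqVlt; apply/orP; left; apply/eqP.
    by field; rewrite expf_neq0// gt_eqF.
  - by rewrite mulr_ge0 ?invr_ge0 ?exprn_ge0// ltW.
  - by rewrite mulr_ge0// ltW.
exists L; split.
- by rewrite /L /M !addSn.
- rewrite /L /M LE natrD; apply: (@le_trans _ _ ((n + 5 + 20 * n.+1)%:R + x)%R).
    by rewrite (addnS n 4) addSn -natr1 -addrA lerD2l addrC.
  have h1 : (0 <= 2 ^+ (n.+2 + 2) * D)%R by rewrite mulr_ge0 ?exprn_ge0 ?(ltW D0).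
  have h2 : (0 <= (n + 5 + 20 * n.+1)%:R * K)%R by rewrite mulr_ge0.
  rewrite /decay_rate DE /x.
  by move: h1 h2; move: (2 ^+ (n.+2 + 2))%R ((n + 5 + 20 * n.+1)%:R)%R => p a; lra.
- case => [|k]; first by rewrite muln0 expr0 invr1; exact: decay_trivial.
  apply: decay_mono (iter k) => //.
  by rewrite ler_pdivrMr// ler_peMr ?invr_ge0 ?exprn_ge0.
Qed.

End decay_exponential.

(** * Sparse families and the exceptional set *)

Section sparse_layers.
Context {R : realType} {n : nat}.
Local Notation E := 'rV[R]_n.+1.
Local Notation mu := (leb R n).
Local Notation meas A := (measurable (A : set (lebT R n))).
Local Notation path := (seq {ffun 'I_n.+1 -> bool}).
Local Notation dc Q s := (cube_set (dcube Q s)).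
Implicit Types (s t u : path).
Variables (Q : cube R n) (F : set (cube R n)) (eta : R).
Hypothesis FQ : F `<=` dyadic Q.
Hypothesis eta01 : (0 < eta < 1)%R.
Hypothesis sF : sparse eta F.

Let S : set path := [set s | F (dcube Q s)].

Lemma dcube_inj s t : dcube Q s = dcube Q t -> s = t.
Proof.
move=> st; have e : size s = size t.
  have := congr1 side st; rewrite !side_dcube => /mulfI.
  move=> /(_ (lt0r_neq0 (side_gt0 Q))) /invr_inj; apply: ieexprIn => //.
  by rewrite -subr_eq0; apply/eqP; lra.
apply: (dcube_inj_size e (cube_set_center (dcube Q s))).
by rewrite {1}st; exact: cube_set_center.
Qed.

Lemma dcube_image : [set dcube Q s | s in S] = F.
Proof.
apply/seteqP; split => [_ [s Fs <-]//|P FP].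
by have /dyadicP[s e] := FQ FP; exists s => //; rewrite /S/= -e.
Qed.

Lemma dcube_proper u t : u != [::] -> dc Q (u ++ t) `<` dc Q t.
Proof.
move=> u0; split; first exact: dcube_sub_cat.
move=> /side_le_subset; rewrite !side_dcube ler_pM2l ?side_gt0//.
rewrite lef_pV2 ?posrE ?exprn_gt0// leNgt => /negP; apply.
by rewrite ltr_eXn2l ?ltr1n// size_cat -{1}(add0n (size t)) ltn_add2r; case: (u) u0.
Qed.

(** Counts the strict ancestors in the family, not the cube itself: if all cubes of the family
    through a point have rank below [k], there are at most [k] of them. *)
Fixpoint rank s : nat := if s is _ :: t then ((t \in S) + rank t)%N else 0%N.

Lemma rank_cat u t : S t -> u != [::] -> (rank t < rank (u ++ t))%N.
Proof.
move=> St; elim: u => // e u IH _ /=; case: (eqVneq u [::]) => [->|u0].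
  by rewrite /= mem_set// add1n.
by rewrite (leq_trans (IH u0))// leq_addl.
Qed.

Definition layer k : set path := [set s | S s /\ rank s = k].

Lemma trivIset_layer k : trivIset (layer k) (fun s => dc Q s).
Proof.
have aux s t x : layer k s -> layer k t -> dc Q s x -> dc Q t x ->
    (size t <= size s)%N -> s = t.
  move=> [Ss rs] [St rt] sx tx ts; have [u e] := dcube_nested sx tx ts.
  have [u0|u0] := eqVneq u [::]; first by rewrite e u0.
  by have := rank_cat St u0; rewrite -e rs rt ltnn.
move=> s t ls lt [x [sx tx]]; have [st|ts] := leqP (size s) (size t).
  by apply/esym/(aux t s x).
exact: (aux s t x ls lt sx tx (ltnW ts)).
Qed.

Lemma layer_parent k s : (0 < rank s)%N -> rank s = k.+1 ->
  exists t u, [/\ layer k t, u != [::] & s = u ++ t].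
Proof.
elim: s => // e s IH _ /=; have [/set_mem Ss|nS] := boolP (s \in S).
  by rewrite add1n => -[rs]; exists s, [:: e].
rewrite add0n => rs; have [t [u [lt u0 e']]] := IH (ltac:(by rewrite rs)) rs.
by exists t, (e :: u); split => //; rewrite e'.
Qed.

Let meta : (0 <= 1 - eta < 1)%R. Proof. by move/andP: eta01 => [? ?]; apply/andP; split; lra. Qed.

(** A cube of layer [k.+1] is strictly inside one of layer [k], and by sparseness such cubes fill at
    most the proportion [1 - eta] of it. *)
Lemma layer_measure k :
  mu (\bigcup_(s in layer k) dc Q s) <= (side Q ^+ n.+1 * (1 - eta) ^+ k)%:E.
Proof.
have /andP[e0 e1] := meta.
elim: k => [|k IH].
  rewrite expr0 mulr1 -leb_cube_set; apply: le_leb => x [s _]; exact: dcube_sub.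
pose V t := \bigcup_(s in [set s | S s /\ dc Q s `<` dc Q t]) dc Q s.
have mV t : meas (V t) by exact: measurable_dcubes.
have VS t : S t -> mu (V t) <= (1 - eta)%:E * mu (dc Q t).
  move=> St; apply: le_trans (sF St); apply: le_leb => x [s [Ss st] sx].
  by exists (dcube Q s).
have sub : \bigcup_(s in layer k.+1) dc Q s `<=` \bigcup_(t in layer k) V t.
  move=> x [s [Ss rs] sx]; have [|t [u [lt u0 e]]] := layer_parent _ rs.
    by rewrite rs.
  by exists t => //; exists s => //; split => //; rewrite e; exact: dcube_proper.
apply: (le_trans (le_leb sub)); apply: (le_trans (leb_bigcup_le _ mV)).
apply: (@le_trans _ _ (wmass (fun=> 1 - eta)%R (\bigcup_(s in layer k) dc Q s))).
  rewrite wmass_trivIset//.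
  - apply: le_esum => t [St _]; rewrite wmass_cst; first exact: VS.
    exact: measurable_cube_set.
  - exact: leb_measurable_cst.
  - by move=> t; exact: measurable_cube_set.
  - exact: trivIset_layer.
rewrite wmass_cst; last exact: measurable_dcubes.
rewrite (exprS _ k) mulrCA EFinM; apply: lee_wpmul2l IH; by rewrite lee_fin.
Qed.

(** Geometric series over the layers. For [k = 0] this is the Carleson packing condition, which
    controls the oscillation part of the exceptional set. *)
Lemma rank_measure k :
  \esum_(s in [set s | S s /\ (k <= rank s)%N]) mu (dc Q s) <=
  (side Q ^+ n.+1 * (1 - eta) ^+ k / eta)%:E.
Proof.
have /andP[e0 e1] := meta; have /andP[h0 h1] := eta01.
have -> : [set s | S s /\ (k <= rank s)%N] = \bigcup_(j in [set: nat]) layer (k + j).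
  apply/seteqP; split => [s [Ss ks]|s [j _ [Ss rs]]].
    by exists (rank s - k)%N => //; split => //; rewrite subnKC.
  by split => //; rewrite rs leq_addr.
rewrite esum_bigcupT; last 2 first.
- by move=> i j _ _ [s [[_ ri] [_ rj]]]; apply/eqP; rewrite -(eqn_add2l k) -ri -rj.
- by move=> s; exact: leb_outer_ge0.
apply: (@le_trans _ _ (\esum_(j in [set: nat])
    (side Q ^+ n.+1 * (1 - eta) ^+ k * (1 - eta) ^+ j)%:E)).
  apply: le_esum => j _; rewrite -mulrA -exprD -leb_trivIset.
  - exact: layer_measure.
  - by move=> s; exact: measurable_cube_set.
  - exact: trivIset_layer.
apply: (le_trans (geometric_esum_le _ _)).
- by rewrite mulr_ge0 ?exprn_ge0// ltW// side_gt0.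
- by apply/andP.
- by rewrite lee_fin subKr.
Qed.

(** A layer is disjoint, so at most one of its cubes contains [x], and only the [k] layers of rank
    below [k] contribute. *)
Lemma sparse_sum_le k (a : cube R n -> \bar R) (M : \bar R) x :
  0 <= M -> (forall P, F P -> 0 <= a P) ->
  (forall s, S s -> dc Q s x -> (rank s < k)%N /\ a (dcube Q s) <= M) ->
  \esum_(P in F) (a P * (\1_(cube_set P) x)%:E) <= k%:R%:E * M.
Proof.
move=> M0 a0 h; rewrite -dcube_image esum_image; last by move=> s t _ _; exact: dcube_inj.
have t0 s : S s -> 0 <= a (dcube Q s) * (\1_(dc Q s) x)%:E.
  by move=> Ss; rewrite mule_ge0 ?a0// lee_fin indicE ler0n.
have layerle j : \esum_(s in layer j) (a (dcube Q s) * (\1_(dc Q s) x)%:E) <= M.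
  have [[s [ls sx]]|ns] := pselect (exists s, layer j s /\ dc Q s x); last first.
    rewrite esum1// => s ls; rewrite indicE memNset ?mule0// => sx.
    by apply: ns; exists s.
  rewrite (esumID [set s])//; last by move=> t [St _]; exact: t0.
  have -> : layer j `&` [set s] = [set s] by apply/seteqP; split => [t []//|t ->].
  rewrite esum_set1; last by apply: t0; exact: ls.1.
  rewrite [X in _ + X]esum1 ?adde0.
    by rewrite indicE mem_set// mule1; apply: (h s ls.1 sx).2.
  move=> t [lt ts]; rewrite indicE memNset ?mule0// => tx; apply: ts => /=.
  by apply: (trivIset_layer lt ls); exists x.
apply: (@le_trans _ _ (\esum_(s in [set s | S s /\ (rank s < k)%N])
    (a (dcube Q s) * (\1_(dc Q s) x)%:E))).
  rewrite (esumID [set s | (rank s < k)%N])//.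
  rewrite [X in _ + X]esum1 ?adde0// => s [Ss sk]; rewrite indicE memNset ?mule0//.
  by move=> sx; apply: sk; exact: (h s Ss sx).1.
elim: k {h} => [|k IH].
  rewrite mul0e (_ : [set s | _] = set0) ?esum_set0//.
  by apply/seteqP; split => // s [].
rewrite (esumID [set s | (rank s < k)%N]); last by move=> s [Ss _]; exact: t0.
rewrite -natr1 EFinD ge0_muleDl ?lee_fin// mul1e; apply: leeD.
  apply: le_trans IH; rewrite le_eqVlt; apply/orP; left; apply/eqP; congr esum.
  apply/seteqP; split => [s [[Ss _] sk]//|s [Ss sk]].
  by split => //; split => //; exact: ltnW.
apply: le_trans (layerle k); rewrite le_eqVlt; apply/orP; left; apply/eqP; congr esum.
apply/seteqP; split => [s [[Ss sk] /negP]|s [Ss rs]].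
  by rewrite -leqNgt => ks; split => //; apply/eqP; rewrite eqn_leq -ltnS sk.
by split; [split => //=; rewrite rs|rewrite /= rs ltnn].
Qed.

End sparse_layers.

Section exceptional_set.
Context {R : realType} {n l : nat}.
Local Notation E := 'rV[R]_n.+1.
Local Notation mu := (leb R n).
Local Notation meas A := (measurable (A : set (lebT R n))).
Local Notation path := (seq {ffun 'I_n.+1 -> bool}).
Local Notation dc Q s := (cube_set (dcube Q s)).
Local Notation triple Q := (dilate (3%:pos)%R Q).
Implicit Types (Q P : cube R n) (s t : path).

Lemma esum_scale_le (I : choiceType) (S : set I) (c : R) (a : I -> \bar R) :
  (0 <= c)%R -> (forall i, 0 <= a i) ->
  \esum_(i in S) (c%:E * a i) <= c%:E * \esum_(i in S) a i.
Proof.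
move=> c0 a0; apply: ge_ereal_sup => _ [X [finX XS] <-]; rewrite fsbig_finite//=.
rewrite -ge0_sume_distrr//; apply: lee_wpmul2l; first by rewrite lee_fin.
by apply: ereal_sup_ubound; exists X => //; rewrite fsbig_finite.
Qed.

Lemma le_prode (I : finType) (P : pred I) (u v : I -> \bar R) :
  (forall i, P i -> 0 <= u i) -> (forall i, P i -> u i <= v i) ->
  \prod_(i | P i) u i <= \prod_(i | P i) v i.
Proof.
move=> u0 uv; pose K (x y : \bar R) := 0 <= x /\ x <= y.
suff [] : K (\prod_(i | P i) u i) (\prod_(i | P i) v i) by [].
apply: (big_ind2 K) => [|x1 x2 y1 y2 [? ?] [? ?]|i Pi]; first by split.
  by split; [exact: mule_ge0|exact: lee_pmul].
by split; [exact: u0|exact: uv].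
Qed.

Variables (Q : cube R n) (F : set (cube R n)) (eta : R).
Hypothesis FQ : F `<=` dyadic Q.
Hypothesis eta01 : (0 < eta < 1)%R.
Hypothesis sF : sparse eta F.
Variables (b : 'I_l -> E -> R) (B : 'I_l -> R).
Hypothesis lb : forall i, loc_integrable (b i).
Hypothesis B0 : forall i, (0 < B i)%R.
Hypothesis bB : forall i, bmo_norm (b i) <= (B i)%:E.

(** The oscillation is relative to the triple, as in the sparse bound; intersecting with the cube
    keeps the set inside [Q], where a decay estimate can be applied. *)
Definition exceptional (k : nat) : set E :=
  (\bigcup_(s in [set s | F (dcube Q s) /\ (k <= rank Q F s)%N]) dc Q s) `|`
  (\bigcup_(i in [set: 'I_l]) \bigcup_(s in [set s | F (dcube Q s)])
     (dc Q s `&` osc_set (b i) (B i) k (triple (dcube Q s)))).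

Lemma measurable_osc_piece k i s :
  meas (dc Q s `&` osc_set (b i) (B i) k (triple (dcube Q s))).
Proof.
by apply: measurableI; [exact: measurable_cube_set|exact: measurable_osc_set].
Qed.

Lemma measurable_exceptional k : meas (exceptional k).
Proof.
apply: measurableU; first exact: measurable_dcubes.
apply: measurable_bigcup_countType => i; apply: measurable_bigcup_countType => s.
exact: measurable_osc_piece.
Qed.

Lemma exceptional_sub k : exceptional k `<=` cube_set Q.
Proof. by move=> x [[s _ /dcube_sub]//|[i _ [s _ [/dcube_sub]]]]. Qed.

(** [r] is a common base for the decay of the layers and that of John-Nirenberg; [3 ^+ n.+1] comes
    from the triples and [1 / eta] from [rank_measure]. *)
Lemma exceptional_measure k (r : R) : (1 - eta <= r)%R -> (2^-1 <= r)%R ->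
  mu (exceptional k) <=
  ((1 + l%:R * 3 ^+ n.+1) / eta * r ^+ k)%:E * mu (cube_set Q).
Proof.
move=> r1 r2; have /andP[e0 e1] := eta01.
pose q := (side Q ^+ n.+1)%R; have q0 : (0 < q)%R by rewrite exprn_gt0// side_gt0.
have rk1 : ((1 - eta) ^+ k <= r ^+ k)%R by rewrite lerXn2r ?nnegrE//; lra.
have rk2 : (2 ^- k <= r ^+ k)%R by rewrite -exprVn lerXn2r ?nnegrE//; lra.
have part1 : mu (\bigcup_(s in [set s | F (dcube Q s) /\ (k <= rank Q F s)%N]) dc Q s) <=
    (q * r ^+ k / eta)%:E.
  apply: (le_trans (leb_bigcup_le _ _)) => [s|]; first exact: measurable_cube_set.
  apply: (le_trans (@rank_measure R n Q F eta eta01 sF k)).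
  by rewrite lee_fin ler_wpM2r ?invr_ge0 ?(ltW e0)// ler_wpM2l ?(ltW q0).
have part2 i : mu (\bigcup_(s in [set s | F (dcube Q s)])
     (dc Q s `&` osc_set (b i) (B i) k (triple (dcube Q s)))) <=
    (3 ^+ n.+1 * r ^+ k * (q / eta))%:E.
  apply: (le_trans (leb_bigcup_le _ _)) => [s|]; first exact: measurable_osc_piece.
  apply: (@le_trans _ _ (\esum_(s in [set s | F (dcube Q s)])
     ((3 ^+ n.+1 * r ^+ k)%:E * mu (dc Q s)))).
    apply: le_esum => s _.
    apply: (@le_trans _ _ (mu (osc_set (b i) (B i) k (triple (dcube Q s))))).
      by apply: le_leb => x [].
    apply: (le_trans (john_nirenberg (lb i) (B0 i) (bB i) k _)).
    rewrite leb_dil muleA -EFinM; apply: lee_wpmul2r; first exact: leb_outer_ge0.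
    by rewrite lee_fin mulrC ler_wpM2l// exprn_ge0.
  have c0 : (0 <= 3 ^+ n.+1 * r ^+ k)%R.
    by rewrite mulr_ge0 ?exprn_ge0//; lra.
  apply: (le_trans (esum_scale_le _ c0 _)) => [s|]; first exact: leb_outer_ge0.
  rewrite [leRHS]EFinM; apply: lee_wpmul2l; first by rewrite lee_fin.
  have := @rank_measure R n Q F eta eta01 sF 0; rewrite expr0 mulr1; apply: le_trans.
  rewrite le_eqVlt; apply/orP; left; apply/eqP; congr esum.
  by apply/seteqP; split => [s //|s []].
have part2' : mu (\bigcup_(i in [set: 'I_l]) \bigcup_(s in [set s | F (dcube Q s)])
     (dc Q s `&` osc_set (b i) (B i) k (triple (dcube Q s)))) <=
     (l%:R * (3 ^+ n.+1 * r ^+ k * (q / eta)))%:E.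
  apply: (le_trans (leb_bigcup_le _ _)) => [i|].
    by apply: measurable_bigcup_countType => s; exact: measurable_osc_piece.
  rewrite -[X in (X%:R * _)%R](card_ord l); apply: esum_finType_le => //.
  have r0 : (0 <= r)%R by lra.
  apply: mulr_ge0; last by apply: divr_ge0; exact: ltW.
  by apply: mulr_ge0; rewrite exprn_ge0.
apply: (le_trans (leb_setU _ _)); apply: (le_trans (leeD part1 part2')).
rewrite leb_cube_set -/q -EFinD -EFinM lee_fin le_eqVlt; apply/orP; left; apply/eqP.
by field; rewrite gt_eqF.
Qed.

End exceptional_set.

(** * Pointwise bound for a summand of the sparse domination *)

Section pointwise.
Context {R : realType} {n l m : nat}.
Local Notation E := 'rV[R]_n.+1.
Local Notation triple Q := (dilate (3%:pos)%R Q).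
Implicit Types (Q P : cube R n).
Variables (lm : (l <= m)%N) (b : 'I_l -> E -> R) (B : 'I_l -> R).
Hypothesis lb : forall i, loc_integrable (b i).
Hypothesis B0 : forall i, (0 < B i)%R.
Hypothesis bB : forall i, bmo_norm (b i) <= (B i)%:E.
Variables (f : 'I_m -> E -> R).
Hypothesis mf : forall i, leb_measurable (f i).

Lemma LlogL_norm_ge0 (g : E -> R) P : 0 <= LlogL_norm g P.
Proof. by apply: le_ereal_inf_tmp => _ [lam [lam0 _] <-]; rewrite lee_fin ltW. Qed.

Lemma avg_ge0 (g : E -> \bar R) P : (forall x, 0 <= g x) -> 0 <= avg g P.
Proof.
move=> g0; rewrite avgE mule_ge0 ?integral_ge0// lee_fin invr_ge0 exprn_ge0//.
by rewrite ltW// side_gt0.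
Qed.

Lemma Rterm_ge0 (c g : E -> R) P gamma x : 0 <= Rterm c g P gamma x.
Proof. rewrite /Rterm/=; case: gamma; first by apply: avg_ge0 => y; rewrite lee_fin.
by apply: mule_ge0; [rewrite lee_fin|apply: avg_ge0 => y; rewrite lee_fin]. Qed.

(** The oscillation sits either inside the mean, where the Hoelder inequality applies, or at the
    point [x], where it is bounded by hypothesis; [a] dominates both constants. *)
Lemma Rterm_le i (g : E -> R) P gamma x (a : R) : leb_measurable g ->
  (@hoelder_const R n <= a)%R -> (`|b i x - mean (b i) (triple P)| <= a * B i)%R ->
  Rterm (b i) g P gamma x <= (a * B i)%:E * LlogL_norm g (triple P).
Proof.
move=> mg Ha ba; rewrite /Rterm; case: gamma.
  apply: (le_trans (LlogL_hoelder _ (lb i) (B0 i) (bB i) mg)).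
  by apply: lee_wpmul2r; [exact: LlogL_norm_ge0|rewrite lee_fin ler_wpM2r// ltW].
apply: lee_pmul; rewrite ?lee_fin//; last exact: avg_le_LlogL.
by apply: avg_ge0.
Qed.

Definition sparse_term P x : \bar R :=
  (\sum_(gamma : {ffun 'I_l -> bool})
     \prod_(s < l) Rterm (b s) (f (widen_ord lm s)) P (gamma s) x)
  * (\prod_(s < m | (l <= s)%N) avg (fun y => `|f s y|%:E) (triple P)).

Lemma sparse_term_ge0 P x : 0 <= sparse_term P x.
Proof.
apply: mule_ge0.
  by apply: sume_ge0 => g _; apply: prode_ge0 => s _; exact: Rterm_ge0.
by apply: prode_ge0 => s _; exact: avg_ge0.
Qed.

Definition norm3 P i := LlogL_norm (f i) (triple P).

(** Each of the [2 ^+ l] choices of [gamma] is bounded by the same product of norms over the triple,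
    which contains [x] and so competes in the maximal function. *)
Lemma sparse_term_le P x (a : R) : cube_set P x -> (@hoelder_const R n <= a)%R ->
  (forall i, (`|b i x - mean (b i) (triple P)| <= a * B i)%R) ->
  sparse_term P x <= (2 ^+ l * (a ^+ l * \prod_(i < l) B i))%:E * LlogL_maximal f x.
Proof.
move=> Px Ha ba.
pose N i := norm3 P i.
have N0 i : 0 <= N i by exact: LlogL_norm_ge0.
have a0 : (0 <= a)%R by exact: le_trans (ltW (hoelder_const_gt0)) Ha.
pose c := (a ^+ l * \prod_(i < l) B i)%R.
have c0 : (0 <= c)%R by rewrite mulr_ge0 ?exprn_ge0// prodr_ge0// => i _; exact: ltW.
pose X := \prod_(s < l) N (widen_ord lm s).
have X0 : 0 <= X by apply: prode_ge0.
have prodle (g : {ffun 'I_l -> bool}) :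
    \prod_(s < l) Rterm (b s) (f (widen_ord lm s)) P (g s) x <= c%:E * X.
  apply: (@le_trans _ _ (\prod_(s < l) ((a * B s)%:E * N (widen_ord lm s)))).
    by apply: le_prode => s _; [exact: Rterm_ge0|exact: Rterm_le].
  rewrite big_split/= -/X prodEFin /c.
  by rewrite big_split/= prodr_const card_ord.
have sumle : \sum_(g : {ffun 'I_l -> bool})
    \prod_(s < l) Rterm (b s) (f (widen_ord lm s)) P (g s) x <= (2 ^+ l * c)%:E * X.
  apply: (@le_trans _ _ (\sum_(g : {ffun 'I_l -> bool}) (c%:E * X))); first exact: lee_sum.
  rewrite -ge0_sume_distrl//.
  rewrite sumEFin sumr_const card_ffun card_bool card_ord -[(c *+ _)%R]mulr_natl natrX//.
pose Y := \prod_(s < m | (l <= s)%N) N s.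
have Yle : \prod_(s < m | (l <= s)%N) avg (fun y => `|f s y|%:E) (triple P) <= Y.
  by apply: le_prode => s _; [exact: avg_ge0|exact: avg_le_LlogL].
have XY : X * Y = \prod_(s < m) N s.
  rewrite (bigID (fun s : 'I_m => (s < l)%N))/= big_ord_narrow; congr (_ * _).
  by apply: eq_bigl => s; rewrite -leqNgt.
apply: (@le_trans _ _ (((2 ^+ l * c)%:E * X) * Y)).
  apply: lee_pmul => //.
    by apply: sume_ge0 => g _; apply: prode_ge0 => s _; exact: Rterm_ge0.
  by apply: prode_ge0 => s _; exact: avg_ge0.
rewrite -muleA XY; apply: lee_wpmul2l; first by rewrite lee_fin mulr_ge0// exprn_ge0.
apply: ereal_sup_ubound; exists (triple P) => //=.
apply/dilP => i; have /andP[? ?] := Px i; have := side_gt0 P => ? /=.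
by apply/andP; split; lra.
Qed.

End pointwise.

(** * Level sets *)

Section level_sets.
Context {R : realType} {n l m : nat}.
Local Notation E := 'rV[R]_n.+1.
Local Notation mu := (leb R n).
Local Notation meas A := (measurable (A : set (lebT R n))).
Local Notation dbl Q := (dilate (2%:pos)%R Q).
Implicit Types (Q P : cube R n).

Lemma LlogL_maximal_ge0 (f : 'I_m -> E -> R) Q x : cube_set Q x ->
  0 <= LlogL_maximal f x.
Proof.
move=> Qx; apply: (@le_trans _ _ (\prod_(i < m) LlogL_norm (f i) Q)).
  by apply: prode_ge0 => i _; exact: LlogL_norm_ge0.
by apply: ereal_sup_ubound; exists Q.
Qed.

(** [2 ^+ l] counts the choices of [gamma]. For [k >= 1], [k] times the sum in parentheses dominates
    both the oscillation off the exceptional set, relative to [B i], and the Hoelder constant. *)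
Definition sparse_const (C : R) : R :=
  (C * (2 ^+ l * (2 ^+ n.+3 + @hoelder_const R n) ^+ l))%R.

Lemma sparse_const_gt0 C : (0 < C)%R -> (0 < sparse_const C)%R.
Proof.
move=> C0; apply: mulr_gt0 => //; apply: mulr_gt0; first exact: exprn_gt0.
by apply: exprn_gt0; apply: addr_gt0; [exact: exprn_gt0|exact: hoelder_const_gt0].
Qed.

Variables (lm : (l <= m)%N) (b : 'I_l -> E -> R) (C eta : R).
Hypothesis lb : forall i, loc_integrable (b i).
Hypothesis C0 : (0 < C)%R.
Hypothesis eta01 : (0 < eta < 1)%R.
Variables (Q : cube R n) (f : 'I_m -> E -> R) (F : set (cube R n)) (g : E -> R).
Hypothesis mf : forall i, leb_measurable (f i).
Hypothesis FQ : F `<=` dyadic Q.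
Hypothesis sF : sparse eta F.
Hypothesis gF : {ae mu, forall x, cube_set Q x ->
  `|g x|%:E <= C%:E * \esum_(P in F) (sparse_term lm b f P x * (\1_(cube_set P) x)%:E)}.

Definition level_set (t : R) : set E :=
  [set x | cube_set Q x /\ t%:E * LlogL_maximal f x < `|g x|%:E].

Section bounds.
Variable B : 'I_l -> R.
Hypothesis B0 : forall i, (0 < B i)%R.
Hypothesis bB : forall i, bmo_norm (b i) <= (B i)%:E.

Lemma level_set_sub (k : nat) (t : R) : (0 < k)%N ->
  (sparse_const C * (k%:R ^+ l.+1 * \prod_(i < l) B i) <= t)%R ->
  exists N, [/\ meas N, mu N = 0 & level_set t `<=` exceptional Q F b B k `|` N].
Proof.
move=> k0 kt; have [N [mN N0 gN]] := gF; exists N; split => // x [Qx tx].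
apply: contrapT => /not_orP[nX nN].
have gx : `|g x|%:E <= C%:E * \esum_(P in F) (sparse_term lm b f P x * (\1_(cube_set P) x)%:E).
  by apply: contrapT => h; apply: nN; apply: gN => /= /(_ Qx).
pose c1 : R := (2 ^+ n.+3 + @hoelder_const R n)%R.
have k1 : (1 <= k%:R :> R)%R by rewrite ler1n.
have p0 : (0 <= \prod_(i < l) B i)%R by apply: prodr_ge0 => i _; exact: ltW.
have H0 := @hoelder_const_gt0 R n.
have c10 : (0 < c1)%R by apply: addr_gt0 => //; exact: exprn_gt0.
have Mx0 := LlogL_maximal_ge0 f Qx.
pose M := (2 ^+ l * ((c1 * k%:R) ^+ l * \prod_(i < l) B i))%R.
have M0 : (0 <= M)%R.
  by rewrite mulr_ge0 ?exprn_ge0// mulr_ge0 ?exprn_ge0// mulr_ge0// ltW.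
have sumle : \esum_(P in F) (sparse_term lm b f P x * (\1_(cube_set P) x)%:E) <=
    k%:R%:E * (M%:E * LlogL_maximal f x).
  apply: (sparse_sum_le FQ) => [|P _|s Ss sx].
  - by rewrite mule_ge0.
  - exact: sparse_term_ge0.
  split.
    by rewrite ltnNge; apply/negP => ks; apply: nX; left; exists s.
  apply: sparse_term_le => //.
    rewrite -[leLHS]mulr1; apply: ler_pM => //; first exact: ltW.
    by rewrite /c1 lerDr exprn_ge0.
  move=> i; apply: (@le_trans _ _ (k%:R * (2 ^+ n.+3 * B i))%R).
    rewrite leNgt; apply/negP => h; apply: nX; right; exists i => //.
    exists s => //; split => //; split => //.
    apply/dilP => j; have /andP[? ?] := sx j; have := side_gt0 (dcube Q s) => ? /=.
    by apply/andP; split; lra.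
  rewrite mulrA (mulrC k%:R)%R ler_wpM2r ?(ltW (B0 i))// ler_wpM2r//.
  by rewrite /c1 lerDl ltW.
move: tx; apply/negP; rewrite -leNgt; apply: (le_trans gx).
apply: (le_trans (lee_wpmul2l _ sumle)); first by rewrite lee_fin ltW.
rewrite !muleA -!EFinM; apply: lee_wpmul2r => //; rewrite lee_fin.
apply: le_trans kt; rewrite le_eqVlt; apply/orP; left; apply/eqP.
by rewrite /sparse_const -/c1 /M (exprS _ l) exprMn; ring.
Qed.

Variable w : E -> R.
Hypothesis w0 : forall x, (0 <= w x)%R.
Hypothesis lw : loc_integrable w.

(** [p0] powers of the base gain a factor 2 and [2 ^+ m0] absorbs the constant in front, so the
    exceptional set has proportion at most [2 ^- (k %/ p0 - m0)]. When the resulting exponent is 0,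
    the claim reduces to the inclusion of [Q] in its double. *)
Lemma level_set_wmass (L p0 m0 k : nat) (t : R) : (0 < L)%N -> (0 < p0)%N ->
  (forall j : nat, decay w (2 ^- (L * j)) (2 ^- j)) ->
  ((Num.max (1 - eta) 2^-1) ^+ p0 <= 2^-1)%R ->
  ((1 + l%:R * 3 ^+ n.+1) / eta <= 2 ^+ m0)%R ->
  ((0 < k)%N -> sparse_const C * (k%:R ^+ l.+1 * \prod_(i < l) B i) <= t)%R ->
  wmass w (level_set t) <=
    (2 ^- ((k %/ p0 - m0) %/ L))%:E * wmass w (cube_set (dbl Q)).
Proof.
move=> L0 p00 dec hp hm kt.
have [k0|k0] := posnP k.
  rewrite k0 div0n sub0n div0n expr0 invr1 mul1e; apply: wmassS => // x [Qx _].
  exact: sub_dilate2.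
have [N [mN N0 sub]] := level_set_sub k0 (kt k0).
apply: (le_trans (wmassS w0 sub)).
have mX : meas (exceptional Q F b B k) by exact: measurable_exceptional.
rewrite wmass_setU_null//; last exact: lw.1.
apply: dec => //; first exact: exceptional_sub.
set q := (k %/ p0)%N.
have [qm|mq] := leqP q m0.
  rewrite (_ : (q - m0 = 0)%N); last by apply/eqP.
  rewrite div0n muln0 expr0 invr1 mul1e; apply: le_leb; exact: exceptional_sub.
pose r : R := Num.max (1 - eta)%R (2^-1)%R.
have r0 : (0 <= r)%R by rewrite /r le_max invr_ge0 ler0n orbT.
have r1 : (r <= 1)%R by move/andP: eta01 => [? ?]; rewrite /r ge_max; apply/andP; split; lra.
have := @exceptional_measure _ _ _ Q F eta eta01 sF b B lb B0 bB k r.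
have rr1 : (1 - eta <= r)%R by rewrite /r le_max lexx.
have rr2 : (2^-1 <= r)%R by rewrite /r le_max lexx orbT.
move=> /(_ rr1 rr2)/le_trans; apply.
apply: lee_wpmul2r; first exact: leb_outer_ge0.
rewrite lee_fin; apply: (@le_trans _ _ (2 ^+ m0 * 2 ^- q)%R).
  apply: ler_pM => //; last 1 first.
  - apply: (@le_trans _ _ (r ^+ (p0 * q))%R).
      by rewrite ler_wiXn2l// mulnC leq_divM.
    by rewrite exprM -exprVn lerXn2r ?nnegrE ?exprn_ge0.
  - move/andP: eta01 => [? ?]; apply: divr_ge0; last exact: ltW.
    by rewrite addr_ge0// mulr_ge0// exprn_ge0.
  - exact: exprn_ge0.
rewrite -{1}(subnK (ltnW mq)) exprD invfM mulrCA mulfV ?expf_neq0// mulr1.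
rewrite lef_pV2 ?posrE ?exprn_gt0// ler_weXn2l ?ler1n//.
by rewrite mulnC leq_divM.
Qed.

End bounds.

End level_sets.

Section exponential_form.
Context {R : realType}.
Local Open Scope ring_scope.

(** The floors and the truncated subtraction amount to a bounded shift, [k <= p0 * L * (m0 + j.+1)];
    the shift gives the factor [2 ^+ m0.+1]. *)
Lemma two_pow_le_exp (L p0 m0 k : nat) (A : R) : (0 < L)%N -> (0 < p0)%N -> L%:R <= A ->
  2 ^- ((k %/ p0 - m0) %/ L) <= 2 ^+ m0.+1 * expR (- (ln 2 / (p0%:R * A) * k%:R)) :> R.
Proof.
move=> L0 p00 LA; set j := (_ %/ L)%N.
have kj : (k <= p0 * L * (m0 + j.+1))%N.
  have h1 : (k < p0 * (k %/ p0).+1)%N by rewrite mulnC ltn_ceil.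
  have h2 : (k %/ p0 - m0 < L * j.+1)%N by rewrite mulnC ltn_ceil.
  have h3 : ((k %/ p0).+1 <= m0 + L * j.+1)%N by lia.
  apply: (leq_trans (ltnW h1)); rewrite -mulnA leq_mul2l; apply/orP; right.
  by apply: (leq_trans h3); rewrite mulnDr leq_add2r leq_pmull.
have ln2 : 0 < ln 2 :> R by rewrite ln_gt0// ltr1n.
have LR : 0 < L%:R :> R by rewrite ltr0n.
have A0 : 0 < A by exact: lt_le_trans LA.
have pR : 0 < p0%:R :> R by rewrite ltr0n.
have e2 i : 2 ^+ i = expR (ln 2 * i%:R) :> R.
  by rewrite mulrC expRM_natl lnK// posrE.
rewrite !e2 -expRN -expRD ler_expR.
have h : k%:R <= p0%:R * A * (m0%:R + j.+1%:R) :> R.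
  apply: (@le_trans _ _ (p0 * L * (m0 + j.+1))%:R); first by rewrite ler_nat.
  by rewrite !natrM natrD ler_wpM2r ?addr_ge0// ler_wpM2l// ltW.
have {h} : k%:R / (p0%:R * A) <= m0%:R + j.+1%:R.
  by rewrite ler_pdivrMr ?mulr_gt0// mulrC.
move=> /(ler_wpM2l (ltW ln2)); rewrite -natr1 -(natr1 m0).
rewrite (_ : ln 2 / (p0%:R * A) * k%:R = ln 2 * (k%:R / (p0%:R * A))); last by ring.
move: (ln 2 * (k%:R / _)) => y; lra.
Qed.

End exponential_form.

Section final_bounds.
Context {R : realType} {n : nat}.
Local Notation E := 'rV[R]_n.+1.

Definition unit_cube (x : E) : cube R n := (x, (1%:pos)%R).

Lemma bmo_norm_ge0 (b : E -> R) : 0 <= bmo_norm b.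
Proof.
pose Q := unit_cube 0%R.
apply: (@le_trans _ _ (avg (fun x => `|b x - mean b Q|%:E) Q)).
  by apply: avg_ge0 => x; rewrite lee_fin.
by apply: ereal_sup_ubound; exists Q.
Qed.

Lemma sub_dilate3 (Q : cube R n) : cube_set Q `<=` cube_set (dilate (3%:pos)%R Q).
Proof.
apply: cube_subset => i; have := side_gt0 Q.
by rewrite /dilate /Defs.center /side/=; split; lra.
Qed.

Lemma maximal_ge0 (f : E -> R) x : 0 <= maximal f x.
Proof.
pose Q := unit_cube x.
have Qx : cube_set Q x.
  by move=> i; rewrite /Q /Defs.center /side/=; apply/andP; split; lra.
apply: (@le_trans _ _ (avg (fun y => `|f y|%:E) Q)).
  by apply: avg_ge0 => y; rewrite lee_fin.
by apply: ereal_sup_ubound; exists Q.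
Qed.

Lemma weak_Ainfty_const_ge0 (w : E -> R) : (forall x, (0 <= w x)%R) ->
  0 <= weak_Ainfty_const w.
Proof.
move=> w0; apply: ereal_sup_ge; eexists; first by exists (unit_cube 0%R).
apply: mule_ge0; first by apply: integral_ge0 => x _; exact: maximal_ge0.
by rewrite inve_ge0 wmass_ge0.
Qed.

Local Open Scope ring_scope.

Lemma expr_le_half (r : R) : 0 <= r < 1 -> exists2 p : nat, (0 < p)%N & r ^+ p <= 2^-1.
Proof.
move=> /andP[r0 r1]; have r1' : `|r| < 1 by rewrite ger0_norm.
have h2 : 0 < 2^-1 :> R by rewrite invr_gt0.
have /cvgrPdist_le/(_ _ h2)[N _ hN] := cvg_expr r1'.
exists N.+1 => //; have := hN N.+1 (leqnSn N).
by rewrite sub0r normrN ger0_norm// exprn_ge0.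
Qed.

Lemma le_pow2 (x : R) : exists k : nat, x <= 2 ^+ k.
Proof.
exists (Num.truncn x).+1; apply: (le_trans (ltW (truncnS_gt x))).
by rewrite -natrX ler_nat ltnW// ltn_expl.
Qed.

(** [k] is the integer part of the solution [x] of [c * (x ^+ l.+1 * p) = t], hence the highest
    level that [t] allows. *)
Lemma root_truncn (l : nat) (c p t : R) : 0 < c -> 0 < p -> 0 < t ->
  exists k : nat, c * (k%:R ^+ l.+1 * p) <= t /\
    c^-1 `^ (l.+1%:R^-1) * (t / p) `^ (l.+1%:R^-1) <= k%:R + 1.
Proof.
move=> c0 p0 t0; set rho := (l.+1%:R^-1 : R).
have tp0 : 0 < t / p by rewrite divr_gt0.
set x := _ * _; have x0 : 0 <= x by rewrite mulr_ge0 ?powR_ge0.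
have xl : x ^+ l.+1 = t / (c * p).
  rewrite /x -powRM ?invr_ge0 ?ltW// -powR_mulrn ?powR_ge0// -powRrM.
  rewrite mulVf ?pnatr_eq0// powRr1; first by rewrite invfM; ring.
  by rewrite mulr_ge0 ?invr_ge0// ltW.
exists (Num.truncn x); split.
  rewrite mulrCA -ler_pdivlMr ?mulr_gt0// -xl lerXn2r ?nnegrE//.
  by rewrite truncn_le.
by rewrite natr1 ltW// truncnS_gt.
Qed.

Lemma prod_small (l : nat) (beta : 'I_l -> R) (i0 : 'I_l) (e : R) :
  (forall i, 0 <= beta i) -> beta i0 = 0 -> 0 < e ->
  exists B : 'I_l -> R, [/\ forall i, 0 < B i, forall i, beta i <= B i &
    \prod_i B i <= e].
Proof.
move=> beta0 bi0 e0; pose M := \prod_(i < l | i != i0) (1 + beta i).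
have b1 i : 0 < 1 + beta i by rewrite ltr_pwDl.
have M0 : 0 < M by apply: prodr_gt0.
exists (fun i => if i == i0 then e / M else 1 + beta i); split => [i|i|].
- by case: eqP => // _; rewrite divr_gt0.
- by case: eqP => [->|_]; [rewrite bi0 ltW// divr_gt0|rewrite lerDr].
rewrite (bigD1 i0)//= eqxx (eq_bigr (fun i => 1 + beta i)); last first.
  by move=> i /negPf ->.
by rewrite -/M divfK// gt_eqF.
Qed.

Lemma expR_decay (y a e : R) : 0 <= y -> 0 < a -> 0 < e ->
  exists2 k : nat, (0 < k)%N & expR (- (a * k%:R)) * y <= e.
Proof.
move=> y0 a0 e0; pose k := (Num.truncn (y / (a * e))).+1; exists k => //.
have ae : 0 < a * e by rewrite mulr_gt0.
have k1 : y / (a * e) < k%:R by exact: truncnS_gt.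
have k2 : y <= k%:R * (a * e) by rewrite -ler_pdivrMr// ltW.
rewrite expRN mulrC ler_pdivrMr ?expR_gt0//; apply: (le_trans k2).
have := expR_ge1Dx (a * k%:R) => h.
rewrite (_ : k%:R * (a * e) = e * (a * k%:R)); last by ring.
by rewrite ler_wpM2l ?(ltW e0)//; lra.
Qed.

End final_bounds.

Theorem corollary1p6 (R : realType) (n l m : nat)
    (l_gt0 : (1 <= l)%N) (lm : (l <= m)%N)
    (D : set ('rV[R]_n.+1 -> R))
    (T : ('I_m -> 'rV[R]_n.+1 -> R) -> 'rV[R]_n.+1 -> R)
    (b : 'I_l -> 'rV[R]_n.+1 -> R)
    (T_multilinear : multilinear_operator D T)
    (D_mulb : forall s f, bounded_compact_support f ->
       D (fun x => (b s x * f x)%R))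
    (b_bmo : forall s, bmo (b s))
    (T_lsd : local_sparse_domination lm T b) :
  exists alpha2 c2 : R, [/\ (0 < alpha2)%R, (0 < c2)%R &
    forall w : 'rV[R]_n.+1 -> R, weight w -> weak_Ainfty w ->
    forall (Q : cube R n) (f : 'I_m -> 'rV[R]_n.+1 -> R),
      (forall s, bounded_compact_support (f s)) ->
      (forall s, [set x | f s x != 0%R] `<=` cube_set Q) ->
    forall t : R, (0 < t)%R ->
      wmass w [set x | cube_set Q x /\
        t%:E * LlogL_maximal f x < `|iter_commutator lm T b f x|%:E]
      <= c2%:E
         * expeR (- (alpha2%:E / (weak_Ainfty_const w + 1)
                     * (t%:E / \prod_(s < l) bmo_norm (b s))
                         `^ (l.+1%:R^-1)%R))
         * wmass w (cube_set (dilate (2%:pos)%R Q))].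
Proof.
have [C [eta [C0 eta01 lsd]]] := T_lsd.
have lb i : loc_integrable (b i) by exact: (b_bmo i).1.
have /andP[e0 e1] := eta01.
have r01 : (0 <= Num.max (1 - eta) 2^-1 < 1)%R.
  by rewrite le_max gt_max; apply/andP; split; [apply/orP; right|apply/andP; split]; lra.
have [p0 p00 hp] := expr_le_half r01.
have [m0 hm] := le_pow2 ((1 + l%:R * 3 ^+ n.+1) / eta)%R.
pose rho : R := (l.+1%:R^-1)%R.
pose c3 := @sparse_const R n l C.
have c30 : (0 < c3)%R by exact: sparse_const_gt0.
pose A0 := @decay_rate R n.
have A01 : (1 <= A0)%R by exact: decay_rate_ge1.
have A00 : (0 < A0)%R by lra.
have pR : (1 <= p0%:R :> R)%R by rewrite ler1n.
have pR0 : (0 < p0%:R :> R)%R by lra.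
have ln2 : (0 < ln 2 :> R)%R by rewrite ln_gt0// ltr1n.
have c2_ge1 : (1 <= 2 ^+ m0.+2 :> R)%R by rewrite exprn_ege1// ler1n.
(* The constant [2 ^+ m0.+2] is twice that of [two_pow_le_exp]; the spare 2 pays for the rounding of
   the level. *)
exists (ln 2 / (p0%:R * A0) * c3^-1 `^ rho)%R, (2 ^+ m0.+2)%R; split.
- by rewrite mulr_gt0 ?divr_gt0 ?mulr_gt0// powR_gt0// invr_gt0.
- by lra.
move=> w [w0 lw] _ Q f bf sf t t0.
set W := wmass w (cube_set (dilate _ Q)).
have W0 : 0 <= W by exact: wmass_ge0.
have Wfin : W \is a fin_num by exact: wmass_cube_fin.
(* The sparse domination concerns the restrictions to [3Q], which change nothing for functions
   supported in [Q]. *)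
have f3 : (fun s y => f s y * \1_(cube_set (dilate 3%:pos Q)) y)%R = f.
  apply/funext => s; apply/funext => y; have [->|fy] := eqVneq (f s y) 0%R.
    by rewrite mul0r.
  rewrite indicE mem_set ?mulr1//; exact/sub_dilate3/(sf s y fy).
have {lsd} [F [FQ sF]] := lsd Q f bf; rewrite f3 => gF.
set S := (X in wmass w X <= _).
have SE : S = level_set Q f (iter_commutator lm T b f) t by [].
(* An infinite constant makes the exponential equal to 1, and the inclusion of [Q] in its double is
   enough. *)
have [Koo|Kfin] := eqVneq (weak_Ainfty_const w) +oo.
  rewrite Koo addye// invey mule0 mul0e oppe0 expeR0 mule1.
  apply: (@le_trans _ _ W); last by rewrite lee_pemull.
  by apply: wmassS => // x [/sub_dilate2].
have K0 := weak_Ainfty_const_ge0 w0.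
have KE : weak_Ainfty_const w = (fine (weak_Ainfty_const w))%:E.
  by rewrite fineK// ge0_fin_numE// ltey.
set K := fine _ in KE; have {}K0 : (0 <= K)%R by rewrite fine_ge0.
rewrite KE; clear Kfin.
have KE' : weak_Ainfty_const w <= K%:E by rewrite KE.
have [L [L0 LA dec]] := decay_exp w0 lw K0 KE'.
have mf i : leb_measurable (f i) by have [] := bf i.
pose a : R := (ln 2 / (p0%:R * (A0 * (K + 1))))%R.
have AK : (1 <= A0 * (K + 1))%R by rewrite mulr_ege1// lerDr.
have pAK : (1 <= p0%:R * (A0 * (K + 1)))%R by rewrite mulr_ege1.
have pAK0 := lt_le_trans ltr01 pAK.
have a0 : (0 < a)%R by rewrite divr_gt0.
have a2 : (a <= ln 2)%R.
  by rewrite ler_pdivrMr ?ler_peMr// ltW.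
(* Stated for arbitrary upper bounds [B] of the norms, so as to serve also when some norm
   vanishes. *)
have main B k : (forall i, 0 < B i)%R -> (forall i, bmo_norm (b i) <= (B i)%:E) ->
    ((0 < k)%N -> c3 * (k%:R ^+ l.+1 * \prod_(i < l) B i) <= t)%R ->
    wmass w S <= (2 ^+ m0.+1 * expR (- (a * k%:R)))%:E * W.
  move=> B0 bB kt; rewrite SE.
  have := level_set_wmass lb C0 eta01 mf FQ sF gF B0 bB w0 lw L0 p00 dec hp hm kt.
  move/le_trans; apply.
  by apply: lee_wpmul2r => //; rewrite lee_fin two_pow_le_exp.
pose beta i := fine (bmo_norm (b i)).
have bE i : bmo_norm (b i) = (beta i)%:E.
  by rewrite fineK// ge0_fin_numE ?bmo_norm_ge0//; exact: (b_bmo i).2.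
have beta0 i : (0 <= beta i)%R by rewrite fine_ge0// bmo_norm_ge0.
under eq_bigr do rewrite bE.
rewrite prodEFin; set P := (\prod_(i < l) beta i)%R.
have K10 : (K + 1 != 0)%R by rewrite gt_eqF//; lra.
(* Since [t / 0 = +oo], the right-hand side is 0 and the mass must be below every [e]: first [k] is
   taken large, then [B] with product so small that [t] allows this [k]. *)
have [P0|P0] := eqVneq P 0%R.
  rewrite P0 inve0 gt0_muley ?lte_fin// /poweR invr_eq0 pnatr_eq0/=.
  rewrite -EFinD inver (negbTE K10) -EFinM gt0_muley; last first.
    rewrite lte_fin divr_gt0//; last by lra.
    by rewrite mulr_gt0 ?divr_gt0 ?mulr_gt0// powR_gt0// invr_gt0.
  rewrite /= mule0 mul0e; apply/lee_addgt0Pr => e ee; rewrite add0e.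
  have W2 : (0 <= 2 ^+ m0.+1 * fine W)%R by rewrite mulr_ge0 ?exprn_ge0// fine_ge0.
  have [k k0 hk] := expR_decay W2 a0 ee.
  have /eqP/prodf_eq0[i0 _ /eqP bi0] := P0.
  have k0R : (0 < c3 * k%:R ^+ l.+1)%R by rewrite mulr_gt0// exprn_gt0// ltr0n.
  have [B [B0 bB PB]] := prod_small beta0 bi0 (divr_gt0 t0 k0R).
  apply: (le_trans (main B k B0 _ _)).
  - by move=> i; rewrite bE lee_fin.
  - by move=> _; rewrite mulrA mulrC -ler_pdivlMr.
  - by rewrite -(fineK Wfin) -EFinM lee_fin (mulrC (2 ^+ _))%R -mulrA.
have Pgt0 : (0 < P)%R by rewrite lt_neqAle eq_sym P0 prodr_ge0.
have beta1 i : (0 < beta i)%R.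
  rewrite lt_neqAle beta0 andbT eq_sym; apply: contraNneq P0 => bi0.
  by apply/prodf_eq0; exists i => //; apply/eqP.
have [k [kt xk]] := root_truncn l c30 Pgt0 t0.
apply: (le_trans (main beta k beta1 _ (fun=> kt))); first by move=> i; rewrite bE.
apply: lee_wpmul2r => //.
have divE (y z : R) : (z != 0)%R -> y%:E / z%:E = (y / z)%:E.
  by move=> z0; rewrite inver (negbTE z0).
rewrite -EFinD !divE// poweR_EFin -[X in expeR (- X)]EFinM -EFinN /=.
rewrite -EFinM lee_fin (exprSr _ m0.+1) -[leRHS]mulrA ler_wpM2l ?exprn_ge0//.
set x := (_ * _)%R in xk.
have -> : (ln 2 / (p0%:R * A0) * c3^-1 `^ rho / (K + 1) * (t / P) `^ l.+1%:R^-1 = a * x)%R.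
  by rewrite /a /x -/rho; field; rewrite K10 !gt_eqF.
(* By [a2], [expR a <= 2]: passing from [k] to [x <= k + 1] costs at most the spare factor 2. *)
have e2 : (expR (ln 2) = 2 :> R)%R by rewrite lnK// posrE.
rewrite -[X in (_ <= X * _)%R]e2 -expRD ler_expR.
have := ler_wpM2l (ltW a0) xk; rewrite mulrDr mulr1; lra.
Qed.
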